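(* Let $\{a_n,b_n\}_{n=1}^\infty$ be Jacobi parameters with $a_n\to1$, $b_n\to0$ and, for some integer $p\ge1$, $$\sum_{n=1}^\infty\bigl(|a_{n+p}-a_n|+|b_{n+p}-b_n|\bigr)<\infty .$$ Then, on any closed interval contained in $$\Bigl\{E=2\cos\theta \ :\ \theta\in(0,\pi),\ \theta\ne\tfrac{\pi}{p},\tfrac{2\pi}{p},\dots,\tfrac{(p-1)\pi}{p}\Bigr\},$$ there is uniform clock behavior.
   Context: Jacobi parameters are bounded sequences $a_n>0$, $b_n\in\mathbb{R}$ ($n\ge 1$). The associated orthonormal polynomials $p_n$ are defined by $p_{-1}=0$, $p_0=1$ and $xp_n(x)=a_{n+1}p_{n+1}(x)+b_{n+1}p_n(x)+a_np_{n-1}(x)$, $n\ge 0$. Let $\nu_n$ be the probability measure giving weight $1/n$ to each of the $n$ (real, simple) zeros of $p_n$; the density of states $\nu$ is the weak limit of $\nu_n$. (When $a_n\to1$, $b_n\to0$ it is known that it exists and $d\nu=\pi^{-1}(4-x^2)^{-1/2}\chi_{[-2,2]}(x)\,dx$.) There is uniform clock behavior on $[\alpha,\beta]$ if $d\nu/dE$ is continuous and nonvanishing on $[\alpha,\beta]$ and $$\lim_{n\to\infty}\ \sup\Bigl\{\Bigl|\,n|E-E'|-\Bigl(\frac{d\nu}{dE}(E)\Bigr)^{-1}\Bigr| \ :\ E,E'\text{ are successive zeros of }p_n\text{ in }[\alpha,\beta]\Bigr\}=0 .$$ *)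

(* Defs.v *)
From HB Require Import structures.
From mathcomp Require Import all_boot all_order all_algebra.
From mathcomp Require Import polyrcf.
From mathcomp Require Import all_classical all_reals all_analysis.

Set Implicit Arguments.
Unset Strict Implicit.
Unset Printing Implicit Defensive.

Import Order.TTheory GRing.Theory Num.Theory.
Import numFieldNormedType.Exports.

Local Open Scope classical_set_scope.
Local Open Scope ring_scope.

(* The sequences are indexed from 1: the values a 0 and b 0 are never used. *)
Definition jacobi_parameters (R : realType) (a b : nat -> R) : Prop :=
  (forall n, (1 <= n)%N -> 0 < a n) /\
  (exists M : R, forall n, (1 <= n)%N -> `|a n| <= M /\ `|b n| <= M).

(* orthopoly_pair a b n = (p_n, p_(n-1)), from
   x p_n = a_(n+1) p_(n+1) + b_(n+1) p_n + a_n p_(n-1),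
   p_0 = 1 and p_(-1) = 0, so that the product a_0 p_(-1) vanishes. *)
Fixpoint orthopoly_pair (R : realType) (a b : nat -> R) (n : nat) :
    {poly R} * {poly R} :=
  if n is m.+1 then
    let: (p, q) := orthopoly_pair a b m in
    ((a m.+1)^-1 *: (('X - (b m.+1)%:P) * p - a m *: q), p)
  else (1, 0).

Definition orthopoly (R : realType) (a b : nat -> R) (n : nat) : {poly R} :=
  (orthopoly_pair a b n).1.

(* rootsR p lists each real root of p once; p_n has n simple real zeros. *)
Definition zero_measure (R : realType) (a b : nat -> R) (n : nat) :
    {measure set (measurableTypeR R) -> \bar R} :=
  let zeros := rootsR (orthopoly a b n) in
  mscale ((n%:R : R)^-1)%:nng
    (msum (fun k => \d_(zeros`_k : measurableTypeR R)) (size zeros)).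

Definition weak_limit (R : realType)
    (mu : nat -> {measure set (measurableTypeR R) -> \bar R})
    (nu : {measure set (measurableTypeR R) -> \bar R}) : Prop :=
  forall f : R -> R, continuous f -> (exists M : R, forall x, `|f x| <= M) ->
    (\int[mu n]_x (f x)%:E)%E @[n --> \oo] --> (\int[nu]_x (f x)%:E)%E.

Definition density_of_states (R : realType) (a b : nat -> R)
    (nu : probability (measurableTypeR R) R) : Prop :=
  weak_limit (zero_measure a b) nu.

(* rho is the density dnu/dE on [alpha, beta]; dnu/dE being defined up to null
   sets, its continuity means that it has a continuous version rho. *)
Definition density_on (R : realType) (nu : probability (measurableTypeR R) R)
    (alpha beta : R) (rho : R -> R) : Prop :=
  forall A : set R, measurable A -> A `<=` `[alpha, beta] ->
    nu A = (\int[lebesgue_measure]_(x in A) (rho x)%:E)%E.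

(* Consecutive distinct zeros, in either order. *)
Definition successive_zeros (R : realType) (p : {poly R}) (x y : R) : Prop :=
  [/\ root p x, root p y, x != y &
      forall z, root p z -> ~~ (Num.min x y < z < Num.max x y)].

(* The real-valued supremum is harmless: the set is finite since p_n has at
   most n zeros, and sup set0 = 0. *)
Definition clock_defect (R : realType) (a b : nat -> R) (rho : R -> R)
    (alpha beta : R) (n : nat) : R :=
  sup [set d : R | exists x y : R,
    [/\ x \in `[alpha, beta]%R, y \in `[alpha, beta]%R,
        successive_zeros (orthopoly a b n) x y &
        d = `| n%:R * `|x - y| - (rho x)^-1 |]].

Definition uniform_clock (R : realType) (a b : nat -> R) (alpha beta : R) :
    Prop :=
  exists (nu : probability (measurableTypeR R) R) (rho : R -> R),
    [/\ density_of_states a b nu,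
        density_on nu alpha beta rho,
        {within `[alpha, beta], continuous rho},
        (forall E, E \in `[alpha, beta]%R -> rho E != 0) &
        clock_defect a b rho alpha beta n @[n --> \oo] --> (0 : R)].

(* Main.v *)
From HB Require Import structures.
Require Import Defs.
From mathcomp Require Import all_boot all_order all_algebra.
From mathcomp Require Import polyrcf.
From mathcomp Require Import all_classical all_reals all_analysis.
From mathcomp Require Import measurable_realfun ring lra.
Import Order.TTheory GRing.Theory Num.Theory.
Import numFieldNormedType.Exports.
Local Open Scope classical_set_scope.
Local Open Scope ring_scope.

(** Write [x = 2 cos th]. In the free case [a = 1], [b = 0] the transfer of the
recurrence over [p] steps is conjugate to the rotation by [p th], and [p_n] is
[sin ((n + 1) th) / sin th], whose zeros have angles spaced by [pi / (n + 1)]. The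
point is that this rotation picture persists, at the scale [1 / n], under the
assumptions on the Jacobi parameters.

The transfer over [p] steps from position [n] has determinant 1 and a half trace
that converges to [cos (p th)]. On a segment of angles where [sin (p th)] does not
vanish it is therefore elliptic for large [n], with eigenvalues
[exp (+- i phi_n)], and its left eigenvector defines coordinates [w_n] of the vector
[(p_n, a_n p_(n-1))] in which it is exactly a rotation by [phi_n] (lemma
[rotate_eigencoord]); the second coordinate of [w_n] is a positive multiple of
[p_n]. From one period to the next these coordinates change by an amount controlled
by the differences [a_(n+p) - a_n] and [b_(n+p) - b_n], so that [w_(n+p)] is the
rotated [w_n] up to a summable relative error (lemma [wkb_step]). Hence the orbit,
with the accumulated rotation undone, converges uniformly and has a nonvanishing
limit. Comparing two angles at distance of order [1 / n], the slowly varying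
amplitudes agree and only the difference of the accumulated phases remains; since
[phi_n] is close to [+- p th] together with its derivative, this difference is
[+- n] times the difference of the angles. This is lemma [wkb_local].

Two statements about zeros follow. Within any window of angular length
[(pi + e) / n] the second coordinate of [w_n] changes sign (lemma [zero_within]).
Two zeros cannot be closer than [(pi - e) / n]: only almost coincident zeros have to
be excluded, and between them there would be a zero of [p_(n-1)] by interlacing,
at which [w_n] is far from horizontal (lemma [zeros_apart]). In terms of [x] the
spacing becomes [2 pi sin th / n], which is the inverse of [n] times the arcsine
density (lemma [clock_spacing]).

The first of these statements also identifies the density of states. It shows that
every cell of angles between exceptional points eventually carries at least its
arcsine mass. Since the zero counting measures have mass at most 1 and the arcsine
law has mass 1, nothing is left over, and the measures converge weakly to the
arcsine law (lemma [weak_limit_arcsine]). *)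

Set Implicit Arguments.
Unset Strict Implicit.
Unset Printing Implicit Defensive.

(** * Solutions of the recurrence and transfer over several steps *)

Section Transfer.
Variable R : realType.
Implicit Types (a b : nat -> R) (n k : nat) (x th : R).

(** Scaling [p_(n-1)] by [a n] gives every transfer matrix determinant 1. *)
Definition orthovec a b n : {poly R} * {poly R} :=
  (orthopoly a b n, a n *: (orthopoly_pair a b n).2).

Definition jacobi_step (an bn : R) (v : {poly R} * {poly R}) :
    {poly R} * {poly R} :=
  (an^-1 *: (('X - bn%:P) * v.1 - v.2), an *: v.1).

Lemma orthovecS a b n :
  orthovec a b n.+1 = jacobi_step (a n.+1) (b n.+1) (orthovec a b n).
Proof.
by rewrite /orthovec /orthopoly /jacobi_step /=; case: (orthopoly_pair a b n).
Qed.

(** The vectors are kept as polynomials, not as values at a point, so that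
convergence and variation of the transfer can be read off coefficients and then
hold uniformly, derivatives included. *)
Fixpoint transfer (A B : nat -> R) n k v :=
  if k is j.+1 then jacobi_step (A (n + j)%N) (B (n + j)%N) (transfer A B n j v)
  else v.

(* the coefficients of the step from position [i] are [a i.+1] and [b i.+1] *)
Lemma transfer_orthovec a b n k :
  transfer (fun i => a i.+1) (fun i => b i.+1) n k (orthovec a b n) =
  orthovec a b (n + k).
Proof.
elim: k => [|k IH]; first by rewrite addn0.
by rewrite /= IH addnS orthovecS.
Qed.

Lemma transfer_linear (A B : nat -> R) n k (u w : {poly R}) :
  transfer A B n k (u, w) =
  ((transfer A B n k (1, 0)).1 * u + (transfer A B n k (0, 1)).1 * w,
   (transfer A B n k (1, 0)).2 * u + (transfer A B n k (0, 1)).2 * w).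
Proof.
elim: k => [|k IH] /=; first by rewrite !mul1r !mul0r addr0 add0r.
rewrite IH /jacobi_step /=; congr pair.
  by rewrite -!scalerAl -scalerDr; congr (_ *: _); ring.
by rewrite -!scalerAl -scalerDr.
Qed.

Lemma transfer_det (A B : nat -> R) n k : (forall i, A i != 0) ->
  (transfer A B n k (1, 0)).1 * (transfer A B n k (0, 1)).2 -
  (transfer A B n k (0, 1)).1 * (transfer A B n k (1, 0)).2 = 1.
Proof.
move=> A0; elim: k => [|k IH] /=; first by rewrite mulr1 mul0r subr0.
rewrite /jacobi_step /= -!scalerAl -!scalerAr !scalerA mulVf ?mulfV //.
by rewrite !scale1r -[RHS]IH; ring.
Qed.

(** With [a = 1], [b = 0] the transfer polynomials are the Chebyshev
polynomials of the second kind. *)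
Lemma free_transfer1 k th :
  let v := transfer (fun=> 1) (fun=> 0) 0 k (1, 0) in
  sin th * v.1.[2 * cos th] = sin (k.+1%:R * th) /\
  sin th * v.2.[2 * cos th] = sin (k%:R * th).
Proof.
elim: k => [|k [IH1 IH2]] /=.
  by rewrite mul1r mul0r sin0 !hornerE.
rewrite invr1 !scale1r; split=> //.
rewrite !hornerE subr0 mulrBr IH2 mulrCA IH1.
have -> : k.+2%:R * th = k.+1%:R * th + th by rewrite -[k.+2%:R]natr1 mulrDl mul1r.
have -> : k%:R * th = k.+1%:R * th - th by rewrite -[k.+1%:R]natr1; ring.
by rewrite sinB sinD; ring.
Qed.

Lemma free_transfer2 k th :
  let v := transfer (fun=> 1) (fun=> 0) 0 k (0, 1) in
  sin th * v.1.[2 * cos th] = - sin (k%:R * th) /\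
  sin th * v.2.[2 * cos th] = - sin ((k%:R - 1) * th).
Proof.
elim: k => [|k [IH1 IH2]] /=.
  by rewrite mul0r sin0 oppr0 sub0r mulN1r sinN opprK !hornerE.
rewrite invr1 !scale1r; split; last by rewrite IH1 -natr1 addrK.
rewrite !hornerE subr0 mulrBr IH2 mulrCA IH1.
have -> : k.+1%:R * th = k%:R * th + th by rewrite -[k.+1%:R]natr1 mulrDl mul1r.
have -> : (k%:R - 1) * th = k%:R * th - th by ring.
by rewrite sinB sinD; ring.
Qed.

(** The free transfer over [k] steps is conjugate to the rotation by [k * th]. *)
Lemma free_transfer_trace k th : sin th != 0 ->
  (transfer (fun=> 1) (fun=> 0) 0 k (1, 0)).1.[2 * cos th] +
  (transfer (fun=> 1) (fun=> 0) 0 k (0, 1)).2.[2 * cos th] =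
  2 * cos (k%:R * th).
Proof.
move=> s0; apply: (mulfI s0); rewrite mulrDr.
have [-> _] := free_transfer1 k th; have [_ ->] := free_transfer2 k th.
have -> : k.+1%:R * th = k%:R * th + th by rewrite -[k.+1%:R]natr1 mulrDl mul1r.
have -> : (k%:R - 1) * th = k%:R * th - th by ring.
by rewrite sinB sinD; ring.
Qed.

Section Zeros.
Variables (a b : nat -> R).
Hypothesis a_gt0 : forall n, (0 < n)%N -> 0 < a n.

(** The recurrence can be run backwards, down to [p_0 = 1]. *)
Lemma orthovec_neq0 n x :
  ~ ((orthovec a b n).1.[x] = 0 /\ (orthovec a b n).2.[x] = 0).
Proof.
elim: n => [|n IH]; first by rewrite /= !hornerE => -[/eqP]; rewrite oner_eq0.
have an0 : a n.+1 != 0 by rewrite gt_eqF ?a_gt0.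
rewrite orthovecS /= !hornerE => -[/eqP + /eqP].
rewrite !mulf_eq0 invr_eq0 (negPf an0) /= => /eqP h /eqP h0.
apply: IH; split=> /=; first exact: h0.
rewrite hornerZ.
by move: h; rewrite h0 mulr0 sub0r => /eqP; rewrite oppr_eq0 => /eqP.
Qed.

Lemma size_orthopoly n : size (orthopoly a b n) = n.+1.
Proof.
suff : size (orthovec a b n).1 = n.+1 /\ (size (orthovec a b n).2 <= n)%N by case.
elim: n => [|n [IH1 IH2]]; first by rewrite /= size_poly1 scaler0 size_poly0.
have an0 : a n.+1 != 0 by rewrite gt_eqF ?a_gt0.
rewrite orthovecS /jacobi_step; move: IH1 IH2; case: (orthovec a b n) => p q /=.
move=> IH1 IH2; rewrite !size_scale ?invr_eq0 // IH1.
have p0 : p != 0 by rewrite -size_poly_gt0 IH1.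
have sXp : size (('X - (b n.+1)%:P) * p) = n.+2.
  by rewrite size_monicM ?monicXsubC // size_XsubC IH1.
by rewrite size_polyDl sXp // size_polyN (leq_ltn_trans IH2).
Qed.

Lemma orthopoly_neq0 n : orthopoly a b n != 0.
Proof. by rewrite -size_poly_gt0 size_orthopoly. Qed.

(** The Wronskian telescopes to the Christoffel-Darboux sum of the squares
[p_k x ^+ 2], [k < n]; it is what makes consecutive polynomials interlace. *)
Lemma wronskian_gt0 n x :
  0 < (orthopoly a b n.+1)^`().[x] * (orthovec a b n.+1).2.[x] -
      (orthopoly a b n.+1).[x] * (orthovec a b n.+1).2^`().[x].
Proof.
set W := fun n => (orthovec a b n).1^`().[x] * (orthovec a b n).2.[x] -
      (orthovec a b n).1.[x] * (orthovec a b n).2^`().[x].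
have WS m : W m.+1 = (orthovec a b m).1.[x] ^+ 2 + W m.
  have am0 : a m.+1 != 0 by rewrite gt_eqF ?a_gt0.
  rewrite /W orthovecS /jacobi_step; case: (orthovec a b m) => p q /=.
  rewrite !derivZ derivB derivM derivB derivX derivC !hornerE /=.
  by field.
have W0 : W 0 = 0.
  by rewrite /W /= scaler0 !derivC !hornerE oppr0.
suff: 0 < W n.+1 by [].
elim: n => [|n IH]; rewrite WS; first by rewrite W0 addr0 /= hornerE expr1n.
by rewrite ltr_wpDl ?sqr_ge0.
Qed.

(** If [q := a_n p_(n-1)] did not vanish between two zeros of [p_n], then
Rolle's theorem for [p_n / q] would contradict the positivity of the
Wronskian. *)
Lemma orthopoly_interlace n x y : x < y ->
  root (orthopoly a b n) x -> root (orthopoly a b n) y ->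
  exists2 z, x <= z <= y & (orthovec a b n).2.[z] = 0.
Proof.
case: n => [|n] xy; first by rewrite /orthopoly /= rootC oner_eq0.
move=> /rootP px /rootP py; apply: contrapT => nz.
set p := orthopoly a b n.+1 in px py *; set q := (orthovec a b n.+1).2.
have q0 z : z \in `[x, y] -> q.[z] != 0.
  by rewrite in_itv /= => zxy; apply/eqP => qz; apply: nz; exists z.
pose f z := p.[z] / q.[z].
have df z : z \in `[x, y] -> is_derive z 1 f
    ((p^`().[z] * q.[z] - p.[z] * q^`().[z]) / q.[z] ^+ 2).
  move=> zxy; have qz := q0 _ zxy.
  have dp := is_derive_poly p z; have dq := is_derive_poly q z.
  have dqV := is_deriveV qz dq.
  apply: (is_derive_eq (is_deriveM dp dqV)).
  by rewrite /GRing.scale /=; field.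
have xymem z : z \in `]x, y[ -> z \in `[x, y].
  by rewrite !in_itv /= => /andP[/ltW -> /ltW ->].
have [| | |c cxy dc0] := @Rolle _ f _ _ xy.
- by move=> z /xymem zxy; have [] := df _ zxy.
- apply: derivable_within_continuous => z zxy.
  by have [] := df _ zxy.
- by rewrite /f px py !mul0r.
have dc := df _ (xymem _ cxy).
have := @derive_val _ _ _ _ _ _ _ dc; rewrite (@derive_val _ _ _ _ _ _ _ dc0).
apply/eqP; rewrite lt_eqF // divr_gt0 ?exprn_even_gt0 ?q0 ?xymem //.
exact: wronskian_gt0.
Qed.

End Zeros.
End Transfer.

(** * Sequences of bounded variation along a period *)

Section Tame.
Variables (R : realType) (p : nat).
Implicit Types (u v : nat -> R) (U V : nat -> {poly R}).

(** A class of sequences stable under the operations that produce the transfer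
polynomials from the Jacobi parameters. *)
Definition tame u (l : R) :=
  u n @[n --> \oo] --> l /\
  exists C : R, forall N, \sum_(n < N) `|u (n + p)%N - u n| <= C.

Lemma cvg_bounded u (l : R) : u n @[n --> \oo] --> l ->
  exists2 K : R, 0 < K & forall n, `|u n| <= K.
Proof.
move=> ul; have /cvg_seq_bounded/pinfty_ex_gt0[K K0 uK] : cvgn u by exact: cvgP ul.
by exists K => // n; exact: uK.
Qed.

Lemma cvg_sumr I (r : seq I) (F : I -> nat -> R) (l : I -> R) :
  (forall i, F i n @[n --> \oo] --> l i) ->
  \sum_(i <- r) F i n @[n --> \oo] --> \sum_(i <- r) l i.
Proof.
move=> Fl; elim: r => [|i r IH].
  by rewrite big_nil; under eq_fun do rewrite big_nil; exact: cvg_cst.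
by rewrite big_cons; under eq_fun do rewrite big_cons; exact: cvgD.
Qed.

Lemma tame_cst (c : R) : tame (fun=> c) c.
Proof.
split; first exact: cvg_cst.
by exists 0 => N; rewrite big1 // => i _; rewrite subrr normr0.
Qed.

Lemma tameD u v l m : tame u l -> tame v m -> tame (fun n => u n + v n) (l + m).
Proof.
move=> [ul [C uC]] [vm [D vD]]; split; first exact: cvgD.
exists (C + D) => N; rewrite (le_trans _ (lerD (uC N) (vD N))) // -big_split /=.
apply: ler_sum => i _; rewrite opprD addrACA; exact: ler_normD.
Qed.

Lemma tameM u v l m : tame u l -> tame v m -> tame (fun n => u n * v n) (l * m).
Proof.
move=> [ul [C uC]] [vm [D vD]]; split; first exact: cvgM.
have [K K0 uK] := cvg_bounded ul; have [L L0 vL] := cvg_bounded vm.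
exists (L * C + K * D) => N.
apply: le_trans (lerD (ler_wpM2l (ltW L0) (uC N)) (ler_wpM2l (ltW K0) (vD N))).
rewrite !mulr_sumr -big_split /=; apply: ler_sum => i _.
have -> : u (i + p)%N * v (i + p)%N - u i * v i =
  v (i + p)%N * (u (i + p)%N - u i) + u i * (v (i + p)%N - v i) by ring.
by rewrite (le_trans (ler_normD _ _)) // !normrM lerD // ler_wpM2r.
Qed.

Lemma tameV u l : (forall n, u n != 0) -> l != 0 ->
  tame u l -> tame (fun n => (u n)^-1) l^-1.
Proof.
move=> u0 l0 [ul [C uC]]; have ulV : (u n)^-1 @[n --> \oo] --> l^-1 by exact: cvgV.
split=> //; have [K K0 uK] := cvg_bounded ulV.
exists (K ^+ 2 * C) => N; apply: le_trans (ler_wpM2l (sqr_ge0 K) (uC N)).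
rewrite mulr_sumr; apply: ler_sum => i _.
have -> : (u (i + p)%N)^-1 - (u i)^-1 =
  (u i)^-1 * (u (i + p)%N)^-1 * (u i - u (i + p)%N) by field; rewrite !u0.
by rewrite !normrM distrC ler_wpM2r // expr2 ler_pM.
Qed.

Lemma tame_shift u l k : tame u l -> tame (fun n => u (n + k)%N) l.
Proof.
move=> [ul [C uC]]; split; first by rewrite -(cvg_shiftn k) in ul.
exists C => N; apply: le_trans (uC (N + k)%N).
rewrite -!(big_mkord xpredT (fun n => `|u (n + p)%N - u n|)).
rewrite [leRHS](@big_cat_nat _ _ _ k) ?leq_addl //=.
rewrite -[X in X <= _]add0r lerD ?sumr_ge0 //.
rewrite -[X in \sum_(X <= _ < _) _]add0n big_addn addnK big_mkord.
by apply: ler_sum => i _; rewrite addnAC.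
Qed.

(** The common bound on the degrees makes coefficientwise convergence uniform on
bounded sets, for the derivatives as well. *)
Definition ptame U (L : {poly R}) :=
  (exists d, (size L <= d)%N /\ forall n, (size (U n) <= d)%N) /\
  forall i, tame (fun n => (U n)`_i) L`_i.

Lemma ptame_cst (L : {poly R}) : ptame (fun=> L) L.
Proof. by split=> [|i]; [exists (size L) | exact: tame_cst]. Qed.

Lemma ptameD U V L M : ptame U L -> ptame V M -> ptame (fun n => U n + V n) (L + M).
Proof.
move=> [[d [Ld Ud]] UL] [[e [Me Ve]] VM]; split.
  exists (maxn d e); split=> [|n]; rewrite (leq_trans (size_polyD _ _)) // geq_max.
    by rewrite (leq_trans Ld) ?leq_maxl // (leq_trans Me) ?leq_maxr.
  by rewrite (leq_trans (Ud n)) ?leq_maxl // (leq_trans (Ve n)) ?leq_maxr.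
move=> i; rewrite coefD; under eq_fun do rewrite coefD.
exact: tameD.
Qed.

Lemma ptameZ u U l L : tame u l -> ptame U L -> ptame (fun n => u n *: U n) (l *: L).
Proof.
move=> ul [[d [Ld Ud]] UL]; split.
  exists d; split=> [|n]; rewrite (leq_trans (size_scale_leq _ _)) //.
move=> i; rewrite coefZ; under eq_fun do rewrite coefZ.
exact: tameM.
Qed.

Lemma ptameN U L : ptame U L -> ptame (fun n => - U n) (- L).
Proof.
move=> UL; rewrite -scaleN1r; under eq_fun do rewrite -scaleN1r.
exact: ptameZ (tame_cst _) UL.
Qed.

Lemma ptameX U L : ptame U L -> ptame (fun n => 'X * U n) ('X * L).
Proof.
move=> [[d [Ld Ud]] UL]; split.
  exists d.+1; split=> [|n]; rewrite (leq_trans (size_polyMleq _ _)) // size_polyX.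
    by rewrite !addSn add0n.
  by rewrite !addSn add0n /= ltnS.
move=> i; rewrite coefXM; under eq_fun do rewrite coefXM.
by case: eqP => _; [exact: tame_cst | exact: UL].
Qed.

Lemma ptame_transfer (A B : nat -> R) k (v : {poly R} * {poly R}) : (forall n, A n != 0) ->
  tame A 1 -> tame B 0 ->
  ptame (fun n => (transfer A B n k v).1) (transfer (fun=> 1) (fun=> 0) 0 k v).1 /\
  ptame (fun n => (transfer A B n k v).2) (transfer (fun=> 1) (fun=> 0) 0 k v).2.
Proof.
move=> A0 tA tB; elim: k => [|k [IH1 IH2]] /=; first by split; exact: ptame_cst.
have tAk : tame (fun n => A (n + k)%N) 1 by exact: tame_shift.
split; last exact: ptameZ.
apply: ptameZ.
  by apply: tameV => //; rewrite oner_eq0.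
apply: ptameD; last exact: ptameN.
rewrite mulrBl; under eq_fun do rewrite mulrBl.
apply: ptameD; first exact: ptameX.
apply: ptameN; rewrite mul_polyC; under eq_fun do rewrite mul_polyC.
by apply: ptameZ => //; exact: tame_shift.
Qed.

Lemma ler_norm_horner (P : {poly R}) d (x : R) : (size P <= d)%N -> `|x| <= 2 ->
  `|P.[x]| <= \sum_(i < d) `|P`_i| * 2 ^+ i.
Proof.
move=> Pd x2; rewrite (horner_coef_wide x Pd) (le_trans (ler_norm_sum _ _ _)) //.
apply: ler_sum => i _; rewrite normrM normrX ler_wpM2l //.
by rewrite lerXn2r ?nnegrE.
Qed.

Lemma ptame_unif U L : ptame U L -> forall e : R, 0 < e ->
  \forall n \near \oo, forall x : R, `|x| <= 2 -> `|(U n).[x] - L.[x]| <= e.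
Proof.
move=> [[d [Ld Ud]] UL] e e0.
have h : \sum_(i < d) `|(U n)`_i - L`_i| * 2 ^+ i @[n --> \oo] --> (0 : R).
  have L0 : \sum_(i < d) `|L`_i - L`_i| * 2 ^+ i = 0 :> R.
    by rewrite big1 // => i _; rewrite subrr normr0 mul0r.
  rewrite -[X in _ --> X]L0.
  apply: (@cvg_sumr _ _ (fun (i : 'I_d) n => `|(U n)`_i - L`_i| * 2 ^+ i)
    (fun i : 'I_d => `|L`_i - L`_i| * 2 ^+ i)) => i.
  apply: cvgMl; apply: cvg_norm; apply: cvgB.
    exact: (UL i).1.
  exact: cvg_cst.
have /cvgrPdist_le/(_ _ e0) := h; apply: filterS => n + x x2.
rewrite sub0r normrN => hn; rewrite -hornerN -hornerD.
have sz : (size (U n - L)%R <= d)%N.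
  by rewrite (leq_trans (size_polyD _ _)) // geq_max size_polyN Ud.
apply: le_trans (ler_norm_horner sz x2) _.
apply: le_trans (le_trans (ler_norm _) hn).
by apply: ler_sum => i _; rewrite coefB.
Qed.

Lemma ptame_deriv_unif U L : ptame U L -> forall e : R, 0 < e ->
  \forall n \near \oo, forall x : R, `|x| <= 2 ->
    `|(U n)^`().[x] - L^`().[x]| <= e.
Proof.
move=> [[d [Ld Ud]] UL]; apply: ptame_unif; split.
  exists d; split=> [|n]; apply: leq_trans (leq_trans (size_poly _ _) (leq_pred _)) _ => //.
move=> i; rewrite coef_deriv; under eq_fun do rewrite coef_deriv.
rewrite -mulr_natr; under eq_fun do rewrite -mulr_natr.
by apply: tameM; [exact: UL | exact: tame_cst].
Qed.

Lemma ptame_variation U L : ptame U L -> exists e : nat -> R,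
  [/\ forall n, 0 <= e n,
      exists C : R, forall N, \sum_(n < N) e n <= C &
      forall n (x : R), `|x| <= 2 -> `|(U (n + p)%N).[x] - (U n).[x]| <= e n].
Proof.
move=> [[d [Ld Ud]] UL].
exists (fun n => \sum_(i < d) `|(U (n + p)%N)`_i - (U n)`_i| * 2 ^+ i); split.
- by move=> n; apply: sumr_ge0 => i _; rewrite mulr_ge0 // exprn_ge0.
- have /choice[C UC] : forall i : nat, exists C : R,
      forall N, \sum_(n < N) `|(U (n + p)%N)`_i - (U n)`_i| <= C.
    by move=> i; exact: (UL i).2.
  exists (\sum_(i < d) C i * 2 ^+ i) => N; rewrite exchange_big /=.
  apply: ler_sum => i _; rewrite -mulr_suml ler_wpM2r //; exact: UC.
- move=> n x x2; rewrite -hornerN -hornerD.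
  have sz : (size (U (n + p)%N - U n)%R <= d)%N.
    by rewrite (leq_trans (size_polyD _ _)) // geq_max size_polyN !Ud.
  apply: le_trans (ler_norm_horner sz x2) _.
  by apply: ler_sum => i _; rewrite coefB.
Qed.

End Tame.

Lemma sum_tail_small (R : realType) (e : nat -> R) (C eta : R) :
  (forall n, 0 <= e n) -> (forall N, \sum_(n < N) e n <= C) -> 0 < eta ->
  \forall M \near \oo, forall n, \sum_(M <= i < n) e i <= eta.
Proof.
move=> e0 eC eta0; set S := fun n => \sum_(i < n) e i.
have S_nd : nondecreasing_seq S.
  apply/nondecreasing_seqP => n; rewrite /S big_ord_recr /=.
  by rewrite lerDl.
have S_cvg : cvgn S.
  apply: nondecreasing_is_cvgn => //.
  by exists C => _ [n _ <-]; exact: eC.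
have lim_ge n : S n <= limn S by exact: nondecreasing_cvgn_le.
have /cvgrPdist_le/(_ _ eta0) := S_cvg; apply: filterS => M HM n.
have [Mn|nM] := leqP M n; last by rewrite big_geq ?ltW // ltnW.
have -> : \sum_(M <= i < n) e i = S n - S M.
  rewrite /S -!(big_mkord xpredT) (@big_cat_nat _ _ _ M 0 n) //=.
  by rewrite addrAC subrr add0r.
apply: le_trans HM; rewrite ger0_norm ?subr_ge0 //.
exact: lerB.
Qed.

(** Orbits advance by whole periods, so they only see every [p]-th error. *)
Lemma sum_stride_le (R : realType) (e : nat -> R) p n k : (0 < p)%N ->
  (forall n, 0 <= e n) ->
  \sum_(j < k) e (n + j * p)%N <= \sum_(n <= i < n + k * p) e i.
Proof.
move=> p0 e0; elim: k => [|k IH]; first by rewrite big_ord0 mul0n addn0 big_geq.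
rewrite big_ord_recr /= (@big_cat_nat _ _ _ (n + k * p)) ?leq_addr //=; last first.
  by rewrite leq_add2l leq_mul2r leqnSn orbT.
apply: lerD => //; rewrite big_ltn; last by rewrite ltn_add2l ltn_mul2r p0 /=.
by rewrite lerDl sumr_ge0.
Qed.

(** Heine-Cantor on a segment. *)
Lemma segment_unif_continuous (R : realType) (V : normedModType R)
    (f : R -> V) (s t : R) :
  {in `[s, t], forall x, {for x, continuous f}} ->
  forall e : R, 0 < e -> exists2 d : R, 0 < d &
    {in `[s, t] &, forall x y, `|x - y| < d -> `|f x - f y| < e}.
Proof.
move=> cf e e0.
have /compact_near_coveringP := @segment_compact R s t.
move=> /(_ R (0^'+)%R (fun d x => forall y, y \in `[s, t]%R -> `|x - y| < d ->
   `|f x - f y| < e)) [].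
  move=> x xst; have e20 : 0 < e / 2 by rewrite divr_gt0.
  have /cf/cvgrPdist_lt/(_ _ e20) : x \in `[s, t]%R by [].
  move=> /nbhs_ballP[r /= r0 Hr]; have r20 : 0 < r / 2 by rewrite divr_gt0.
  exists (ball x (r / 2), [set d | d < r / 2]).
    by split; [exact: nbhsx_ballx | exact: nbhs_right_lt].
  move=> [z d] /= [xz dr] y yst zy.
  have fz : `|f x - f z| < e / 2.
    by apply: Hr; apply: le_ball xz; rewrite ler_pdivrMr // ler_peMr ?ltW ?ltr1n.
  have fy : `|f x - f y| < e / 2.
    apply: Hr; rewrite /ball /= (le_lt_trans (ler_distD z _ _)) //.
    by rewrite [r]splitr ltrD // (lt_trans zy).
  rewrite (le_lt_trans (ler_distD (f x) _ _)) // [e]splitr ltrD // distrC //.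
move=> d /= d0 Hd; exists (d / 2); first by rewrite divr_gt0.
move=> x y xst yst xy; apply: (Hd (d / 2)) => //=.
- by rewrite sub0r normrN gtr0_norm ?divr_gt0 // ltr_pdivrMr // ltr_pMr ?ltr1n.
- by rewrite divr_gt0.
Qed.

(** * Angles *)

Section Angles.
Variable R : realType.
Implicit Types (x y u : R).

Lemma ler_cos x y : 0 <= x -> x <= y -> y <= pi -> cos y <= cos x.
Proof.
move=> x0 xy ypi; have [y0 xpi] := (le_trans x0 xy, le_trans xy ypi).
by rewrite leNgt ltr_cos ?in_itv /= ?x0 ?y0 ?xpi ?ypi // -leNgt.
Qed.

Lemma two_cos_itv u : 0 < u < pi -> 2 * cos u \in `]-2, 2[.
Proof.
move=> /andP[u0 upi]; have h0 : 0 \in `[0, pi :> R] by rewrite in_itv /= lexx pi_ge0.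
have hpi : pi \in `[0, pi :> R] by rewrite in_itv /= lexx pi_ge0.
have hu : u \in `[0, pi] by rewrite in_itv /= !ltW.
have c1 : cos u < 1 by rewrite -cos0 ltr_cos.
have c2 : -1 < cos u by rewrite -cospi ltr_cos.
by rewrite in_itv /=; apply/andP; split; lra.
Qed.

Lemma two_cos_surj x : -2 <= x <= 2 -> exists2 y, 0 <= y <= pi & x = 2 * cos y.
Proof.
move=> x2; have c1 : -1 <= x / 2 <= 1 by move: x2 => /andP[]; lra.
exists (acos (x / 2)); first by rewrite acos_ge0 ?acos_lepi.
by rewrite acosK ?in_itv //; field.
Qed.

Lemma sin_eq0_natpi x : 0 <= x -> sin x = 0 -> exists k : nat, x = k%:R * pi.
Proof.
move=> x0 sx; have pi0 := pi_gt0 R; pose k := Num.truncn (x / pi).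
have xpi : 0 <= x / pi by rewrite divr_ge0 // ltW.
have /andP[k1 k2] := truncn_itv xpi; rewrite -/k in k1 k2.
rewrite ler_pdivlMr // in k1; rewrite ltr_pdivrMr // in k2.
exists k; apply/eqP; rewrite eq_le k1 andbT leNgt; apply/negP => kx.
have xE : x = (x - k%:R * pi) + pi *+ k by rewrite -[pi *+ k]mulr_natl subrK.
move: sx; rewrite xE (alternatingn (@sinDpi R)) => /eqP.
rewrite mulf_eq0 signr_eq0 /= gt_eqF // sin_gt0_pi // subr_gt0 kx /=.
by rewrite ltrBlDr (lt_le_trans k2) // -natr1 mulrDl mul1r addrC.
Qed.

End Angles.

(** * Perturbed rotations of the plane *)

Section Rotation.
Variable R : realType.
Implicit Types (x y h : R) (v w : R * R).

Lemma ler_dist_sin x y : `|sin x - sin y| <= `|x - y|.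
Proof.
wlog xy : x y / y <= x => [hw|].
  have [/hw //|/ltW/hw] := leP y x.
  by rewrite distrC [X in _ <= X]distrC.
have [|c _ ->] := @MVT_segment _ sin cos _ _ xy.
  exact/continuous_subspaceT/continuous_sin.
by rewrite normrM ler_piMl // cos_max.
Qed.

Lemma ler_dist_cos x y : `|cos x - cos y| <= `|x - y|.
Proof.
rewrite -!sinDpihalf (le_trans (ler_dist_sin _ _)) //.
by rewrite opprD addrACA subrr addr0.
Qed.

Definition rotate h w : R * R :=
  (cos h * w.1 - sin h * w.2, sin h * w.1 + cos h * w.2).

Lemma rotateD x y w : rotate (x + y) w = rotate x (rotate y w).
Proof. by rewrite /rotate /= cosD sinD; congr pair; ring. Qed.

Lemma rotate0 w : rotate 0 w = w.
Proof. by case: w => a b; rewrite /rotate /= cos0 sin0 !mul1r !mul0r subr0 add0r. Qed.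

Lemma rotateBr h v w : rotate h (v - w) = rotate h v - rotate h w.
Proof. by rewrite /rotate; apply/pair_equal_spec; split => /=; ring. Qed.

Lemma norm_pair_le w x : (`|w| <= x) = (`|w.1| <= x) && (`|w.2| <= x).
Proof. by rewrite prod_normE ge_max. Qed.

Lemma norm_fst_le w : `|w.1| <= `|w|.
Proof. by rewrite prod_normE le_max lexx. Qed.

Lemma norm_snd_le w : `|w.2| <= `|w|.
Proof. by rewrite prod_normE le_max lexx orbT. Qed.

(* in the maximum norm a rotation is only bounded by 2 *)
Lemma norm_rotate_le h w : `|rotate h w| <= 2 * `|w|.
Proof.
have [c1 s1] := (cos_max h, sin_max h).
have [w1 w2] := (norm_fst_le w, norm_snd_le w).
rewrite norm_pair_le /rotate /=; apply/andP; split.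
  rewrite (le_trans (ler_normB _ _)) // !normrM mulr2n mulrDl !mul1r.
  by rewrite lerD // -[leRHS]mul1r ler_pM.
rewrite (le_trans (ler_normD _ _)) // !normrM mulr2n mulrDl !mul1r.
by rewrite lerD // -[leRHS]mul1r ler_pM.
Qed.

Lemma dist_rotate_le x y w : `|rotate x w - rotate y w| <= 2 * `|x - y| * `|w|.
Proof.
have [c1 s1] := (ler_dist_cos x y, ler_dist_sin x y).
have [w1 w2] := (norm_fst_le w, norm_snd_le w).
rewrite norm_pair_le /rotate /=; apply/andP; split.
  have -> : cos x * w.1 - sin x * w.2 - (cos y * w.1 - sin y * w.2) =
    (cos x - cos y) * w.1 - (sin x - sin y) * w.2 by ring.
  rewrite (le_trans (ler_normB _ _)) // !normrM mulr2n 2!mulrDl !mul1r.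
  by rewrite lerD // ler_pM.
have -> : sin x * w.1 + cos x * w.2 - (sin y * w.1 + cos y * w.2) =
  (sin x - sin y) * w.1 + (cos x - cos y) * w.2 by ring.
rewrite (le_trans (ler_normD _ _)) // !normrM mulr2n 2!mulrDl !mul1r.
by rewrite lerD // ler_pM.
Qed.

(** Undoing the accumulated rotation turns each step into a displacement of
relative size [4 * eps j], so the orbit stays close to a rotated copy of its
starting point. *)
Lemma rotate_orbit (w : nat -> R * R) (phi eps : nat -> R) (eta : R) k :
  eta <= 8^-1 -> (forall j, 0 <= eps j) ->
  (forall j, (j < k)%N -> `|w j.+1 - rotate (phi j) (w j)| <= eps j * `|w j|) ->
  \sum_(j < k) eps j <= eta ->
  `|rotate (- \sum_(j < k) phi j) (w k) - w 0| <= 8 * eta * `|w 0|.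
Proof.
move=> eta8 e0 hw heta.
apply: le_trans (_ : 8 * (\sum_(j < k) eps j) * `|w 0| <= _); last first.
  by rewrite ler_wpM2r // ler_pM2l.
move: (le_trans heta eta8); elim: k hw {heta} => [|k IH] hw.
  by rewrite !big_ord0 oppr0 rotate0 subrr normr0 mulr0 mul0r.
rewrite !big_ord_recr /=; set S := \sum_(j < k) eps j.
set Phi := \sum_(j < k) phi j => Sk.
have S8 : S <= 8^-1 by rewrite (le_trans _ Sk) // lerDl.
have {}IH := IH (fun j jk => hw j (ltnW jk)) S8.
have ck : `|rotate (- Phi) (w k)| <= 2 * `|w 0|.
  rewrite -[rotate _ _](subrK (w 0)) (le_trans (ler_normD _ _)) //.
  rewrite mulr2n mulrDl mul1r lerD // (le_trans IH) // ler_piMl //.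
  by rewrite mulrC -ler_pdivlMr // mul1r.
have wk : `|w k| <= 4 * `|w 0|.
  have -> : w k = rotate Phi (rotate (- Phi) (w k)) by rewrite -rotateD subrr rotate0.
  rewrite (le_trans (norm_rotate_le _ _)) // [4](_ : _ = 2 * 2) -?mulrA; last by ring.
  by rewrite ler_pM2l.
have -> : rotate (- (Phi + phi k)) (w k.+1) - w 0 =
  rotate (- (Phi + phi k)) (w k.+1 - rotate (phi k) (w k)) + (rotate (- Phi) (w k) - w 0).
  by rewrite rotateBr -rotateD opprD subrK addrA subrK.
rewrite (le_trans (ler_normD _ _)) // mulrDr mulrDl addrC lerD //.
rewrite (le_trans (norm_rotate_le _ _)) // (_ : 8 = 2 * 4); last by ring.
rewrite -!mulrA ler_pM2l // (le_trans (hw _ _)) // mulrCA.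
by rewrite ler_wpM2l.
Qed.

(** Each orbit is compared with the rotated copy of its own start; between the two
orbits only the starts and the total phases are compared. *)
Lemma rotate_orbit_compare (v w : nat -> R * R) (psi phi eps : nat -> R)
    (eta h : R) k :
  eta <= 16^-1 -> (forall j, 0 <= eps j) -> \sum_(j < k) eps j <= eta ->
  (forall j, (j < k)%N -> `|v j.+1 - rotate (psi j) (v j)| <= eps j * `|v j|) ->
  (forall j, (j < k)%N -> `|w j.+1 - rotate (phi j) (w j)| <= eps j * `|w j|) ->
  `|v 0 - w 0| <= eta * `|w 0| ->
  `|\sum_(j < k) psi j - \sum_(j < k) phi j - h| <= eta ->
  `|v k - rotate h (w k)| <= 272 * eta * `|w k|.
Proof.
move=> eta16 e0 heta hv hw hvw hphi.
have eta8 : eta <= 8^-1 by rewrite (le_trans eta16) // lef_pV2 ?posrE // ler_nat.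
have eta0 : 0 <= eta by rewrite (le_trans _ heta) // sumr_ge0.
have := rotate_orbit eta8 e0 hv heta; have := rotate_orbit eta8 e0 hw heta.
set Phi := \sum_(j < k) phi j in hphi *; set Psi := \sum_(j < k) psi j in hphi *.
set c := rotate (- Phi) (w k); set d := rotate (- Psi) (v k) => hc hd.
have wk : w k = rotate Phi c by rewrite -rotateD subrr rotate0.
have vk : v k = rotate Psi d by rewrite -rotateD subrr rotate0.
have v0 : `|v 0| <= 2 * `|w 0|.
  rewrite -[v 0](subrK (w 0)) (le_trans (ler_normD _ _)) //.
  rewrite mulr2n mulrDl mul1r lerD // (le_trans hvw) // ler_piMl //.
  by rewrite (le_trans eta8) // invf_le1 ?ler1n.
have w0 : `|w 0| <= 4 * `|w k|.
  have : `|w 0| <= `|c| + `|w 0| / 2.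
    rewrite -[w 0 in leLHS](subKr c) (le_trans (ler_normB _ _)) // lerD //.
    rewrite (le_trans hc) // mulrC ler_wpM2l //.
    by move: eta16; lra.
  have := norm_rotate_le (- Phi) (w k); rewrite -/c; lra.
(* four displacements, at most [32 + 2 + 2 + 32 = 68] times [eta * `|w 0|] *)
have -> : v k - rotate h (w k) =
  rotate Psi (d - v 0) + rotate Psi (v 0 - w 0) +
  (rotate Psi (w 0) - rotate (h + Phi) (w 0)) - rotate h (rotate Phi (c - w 0)).
  rewrite {1}vk wk !rotateBr -!rotateD.
  by rewrite opprB !addrA !subrK.
have n1 : `|rotate Psi (d - v 0)| <= 32 * (eta * `|w 0|).
  apply: le_trans (norm_rotate_le _ _) _.
  have := ler_wpM2l eta0 v0; lra.
have n2 : `|rotate Psi (v 0 - w 0)| <= 2 * (eta * `|w 0|).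
  by apply: le_trans (norm_rotate_le _ _) _; rewrite ler_wpM2l.
have n3 : `|rotate Psi (w 0) - rotate (h + Phi) (w 0)| <= 2 * (eta * `|w 0|).
  apply: le_trans (dist_rotate_le _ _ _) _; rewrite -mulrA ler_wpM2l // ler_wpM2r //.
  by rewrite opprD addrA addrAC.
have n4 : `|rotate h (rotate Phi (c - w 0))| <= 32 * (eta * `|w 0|).
  apply: le_trans (norm_rotate_le _ _) _.
  have := norm_rotate_le Phi (c - w 0); lra.
have := ler_wpM2l eta0 w0.
move=> w0'; apply: le_trans (ler_normB _ _) _.
have n12 := ler_normD (rotate Psi (d - v 0)) (rotate Psi (v 0 - w 0)).
have n123 := ler_normD (rotate Psi (d - v 0) + rotate Psi (v 0 - w 0))
  (rotate Psi (w 0) - rotate (h + Phi) (w 0)).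
lra.
Qed.

End Rotation.

(** * Approximate diagonalization of the transfer over one period *)

Section EigenCoordinates.
Variable R : realType.
Implicit Types (al be ga de tau P Q c K : R).

(** For a real 2x2 matrix [[al, be], [ga, de]] of determinant 1 and trace
[2 tau] with [|tau| < 1], the row [(e^(i phi) - de, be)], [phi = acos tau], is a
left eigenvector for the eigenvalue [e^(i phi)]; this is its pairing with
[(P, Q)], written in real and imaginary part. *)
Definition eigencoord tau de be P Q : R * R :=
  ((tau - de) * P + be * Q, Num.sqrt (1 - tau ^+ 2) * P).

Lemma sqr_le1_itv tau : 0 <= 1 - tau ^+ 2 -> -1 <= tau <= 1.
Proof.
rewrite subr_ge0 => h; rewrite -ler_norml.
by rewrite -[leLHS]ger0_norm // -ler_sqr ?nnegrE // real_normK ?num_real ?expr1n ?normr_id // real_normK ?num_real.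
Qed.

Lemma rotate_eigencoord al be ga de tau P Q : al * de - be * ga = 1 ->
  al + de = 2 * tau -> 0 <= 1 - tau ^+ 2 ->
  rotate (acos tau) (eigencoord tau de be P Q) =
  eigencoord tau de be (al * P + be * Q) (ga * P + de * Q).
Proof.
move=> hdet htr htau; have tau1 := sqr_le1_itv htau.
have s2 := sqr_sqrtr htau.
rewrite /rotate /eigencoord /= sin_acos // acosK ?in_itv //=.
set s := Num.sqrt _ in s2 *.
have eal : al = 2 * tau - de by rewrite -htr addrK.
have hbg : be * ga = (2 * tau - de) * de - 1 by rewrite -eal -hdet; ring.
rewrite eal.
congr pair; last by ring.
have -> : tau * ((tau - de) * P + be * Q) - s * (s * P) =
  tau * ((tau - de) * P + be * Q) - s ^+ 2 * P by ring.
rewrite s2.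
have -> : (tau - de) * ((2 * tau - de) * P + be * Q) + be * (ga * P + de * Q) =
  (tau - de) * ((2 * tau - de) * P + be * Q) + be * ga * P + be * de * Q by ring.
by rewrite hbg; ring.
Qed.

(** The lower bounds on [be] and [sqrt (1 - tau ^ 2)] let the coordinates control
[(P, Q)]. After one step the vector is rotated exactly in the old coordinates, so
the relative error in the new ones is of the size of the change of the matrix. *)
Lemma eigencoord_drift c K : 0 < c -> 0 <= K -> exists2 M : R, 0 <= M &
  forall al be ga de tau P Q be' de' tau',
  `|al| <= K -> `|be| <= K -> `|ga| <= K -> `|de| <= K -> c <= `|be| ->
  c <= Num.sqrt (1 - tau ^+ 2) -> c <= Num.sqrt (1 - tau' ^+ 2) ->
  al * de - be * ga = 1 -> al + de = 2 * tau ->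
  `|eigencoord tau' de' be' (al * P + be * Q) (ga * P + de * Q) -
    rotate (acos tau) (eigencoord tau de be P Q)|
  <= M * (`|tau' - tau| + `|de' - de| + `|be' - be|) * `|eigencoord tau de be P Q|.
Proof.
move=> c0 K0; pose A := c^-1 + c^-1 * (1 + (1 + K) * c^-1).
have cV0 : 0 <= c^-1 by rewrite invr_ge0 ltW.
have A0 : 0 <= A by rewrite /A addr_ge0 // mulr_ge0 // addr_ge0 // mulr_ge0 // addr_ge0.
exists (2 * K * A * (1 + c^-1)).
  by rewrite !mulr_ge0 // addr_ge0.
move=> al be ga de tau P Q be' de' tau' alK beK gaK deK cbe cs cs' hdet htr.
set P' := al * P + be * Q; set Q' := ga * P + de * Q.
have pos x : c <= Num.sqrt (1 - x ^+ 2) -> 0 <= 1 - x ^+ 2.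
  by move=> h; rewrite ltW // -sqrtr_gt0 (lt_le_trans c0).
have [t0 t0'] := (pos _ cs, pos _ cs').
rewrite (rotate_eigencoord P Q hdet htr t0) -/P' -/Q'.
have tau1 : `|tau| <= 1 by rewrite ler_norml sqr_le1_itv.
have tau1' : `|tau'| <= 1 by rewrite ler_norml sqr_le1_itv.
set w := eigencoord tau de be P Q.
have Pw : `|P| <= c^-1 * `|w|.
  rewrite ler_pdivlMl // (le_trans _ (norm_snd_le w)) // /w /= normrM.
  by rewrite ler_wpM2r // (le_trans cs) // ler_norm.
have Qw : `|Q| <= c^-1 * (1 + (1 + K) * c^-1) * `|w|.
  rewrite -mulrA ler_pdivlMl // (le_trans (ler_wpM2r _ cbe)) //.
  rewrite -normrM; have -> : be * Q = w.1 - (tau - de) * P by rewrite /w /=; ring.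
  rewrite (le_trans (ler_normB _ _)) // [leRHS]mulrDl mul1r lerD ?norm_fst_le //.
  rewrite normrM -mulrA ler_pM // (le_trans (ler_normB _ _)) //.
  by rewrite lerD.
have PA : `|P| <= A * `|w|.
  rewrite (le_trans Pw) // ler_wpM2r // /A lerDl mulr_ge0 // addr_ge0 // mulr_ge0 //.
  by rewrite addr_ge0.
have QA : `|Q| <= A * `|w|.
  by rewrite (le_trans Qw) // ler_wpM2r // /A lerDr.
have comb x y : `|x| <= K -> `|y| <= K -> `|x * P + y * Q| <= 2 * K * A * `|w|.
  move=> xK yK; rewrite (le_trans (ler_normD _ _)) // !normrM.
  have -> : 2 * K * A * `|w| = K * (A * `|w|) + K * (A * `|w|) by ring.
  by rewrite lerD // ler_pM.
have PB : `|P'| <= 2 * K * A * `|w| by exact: comb.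
have QB : `|Q'| <= 2 * K * A * `|w| by exact: comb.
set B := 2 * K * A * `|w| in PB QB.
have B0 : 0 <= B by exact: le_trans PB.
have -> : 2 * K * A * (1 + c^-1) * (`|tau' - tau| + `|de' - de| + `|be' - be|) * `|w|
  = (`|tau' - tau| + `|de' - de| + `|be' - be|) * (1 + c^-1) * B by rewrite /B; ring.
set E := _ + _ + _.
have E0 : 0 <= E by rewrite !addr_ge0.
rewrite norm_pair_le /eigencoord /=; apply/andP; split.
  have -> : (tau' - de') * P' + be' * Q' - ((tau - de) * P' + be * Q') =
    (tau' - tau) * P' - (de' - de) * P' + (be' - be) * Q' by ring.
  apply: le_trans (_ : E * B <= _); last first.
    by rewrite ler_wpM2r // ler_peMr // lerDl.
  rewrite (le_trans (ler_normD _ _)) // /E [leRHS]mulrDl lerD //; last first.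
    by rewrite normrM ler_pM.
  by rewrite (le_trans (ler_normB _ _)) // [leRHS]mulrDl !normrM lerD // ler_pM.
rewrite -mulrBl normrM ler_pM //.
set r := Num.sqrt (1 - tau ^+ 2) in cs *; set r' := Num.sqrt _ in cs' *.
have hr : (r' - r) * (r' + r) = (tau - tau') * (tau + tau').
  have -> : (r' - r) * (r' + r) = r' ^+ 2 - r ^+ 2 by ring.
  by rewrite !sqr_sqrtr //; ring.
have rr0 : 2 * c <= r' + r by lra.
have : `|r' - r| * (2 * c) <= `|tau' - tau| * 2.
  apply: le_trans (_ : `|(r' - r) * (r' + r)| <= _).
    by rewrite normrM ler_wpM2l // (le_trans rr0) // ler_norm.
  rewrite hr normrM distrC ler_wpM2l // (le_trans (ler_normD _ _)) //.
  by rewrite (_ : 2 = 1 + 1) ?lerD.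
rewrite mulrA [X in X * c]mulrC -mulrA mulrC ler_pM2r // -ler_pdivlMr // => hd.
apply: le_trans hd _; rewrite ler_pM //; first by rewrite /E -addrA lerDl addr_ge0.
by rewrite lerDr.
Qed.

End EigenCoordinates.

(** * Local asymptotics of the solution on a good segment *)

Section LocalPhase.
Variables (R : realType) (a b : nat -> R) (p : nat).
Hypothesis a_gt0 : forall n, (0 < n)%N -> 0 < a n.
Hypothesis a_tame : tame p (fun n => a n.+1) 1.
Hypothesis b_tame : tame p (fun n => b n.+1) 0.
Hypothesis p_gt0 : (0 < p)%N.
Implicit Types (n : nat) (x y : R).

Let T n v := transfer (fun i => a i.+1) (fun i => b i.+1) n p v.
Let TL (v : {poly R} * {poly R}) := transfer (fun=> 1) (fun=> 0) 0 p v.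
Let al n := (T n (1, 0)).1.
Let be n := (T n (0, 1)).1.
Let ga n := (T n (1, 0)).2.
Let de n := (T n (0, 1)).2.

Let a_neq0 n : a n.+1 != 0. Proof. by rewrite gt_eqF ?a_gt0. Qed.

Definition half_trace n x : R := (al n + de n).[2 * cos x] / 2.

(** Named after the WKB approximation: a slowly varying amplitude times the
exponential of an accumulated phase. *)
Definition wkb n x : R * R :=
  eigencoord (half_trace n x) (de n).[2 * cos x] (be n).[2 * cos x]
    (orthopoly a b n).[2 * cos x] (orthovec a b n).2.[2 * cos x].

Let tame_al : ptame p al (TL (1, 0)).1.
Proof. exact: (ptame_transfer p (1, 0) a_neq0 a_tame b_tame).1. Qed.
Let tame_ga : ptame p ga (TL (1, 0)).2.
Proof. exact: (ptame_transfer p (1, 0) a_neq0 a_tame b_tame).2. Qed.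
Let tame_be : ptame p be (TL (0, 1)).1.
Proof. exact: (ptame_transfer p (0, 1) a_neq0 a_tame b_tame).1. Qed.
Let tame_de : ptame p de (TL (0, 1)).2.
Proof. exact: (ptame_transfer p (0, 1) a_neq0 a_tame b_tame).2. Qed.
Let tame_tr : ptame p (fun n => al n + de n) ((TL (1, 0)).1 + (TL (0, 1)).2).
Proof. exact: ptameD. Qed.

Let le2cos x : `|2 * cos x| <= 2.
Proof. by rewrite normrM normr_nat ler_piMr // cos_max. Qed.

Lemma continuous_horner_cos (P : {poly R}) : continuous (fun x : R => P.[2 * cos x]).
Proof.
move=> x; apply: (@continuous_comp _ _ _ (fun x : R => 2 * cos x) (horner P)).
  by apply: cvgM; [exact: cvg_cst | exact: continuous_cos].
apply: differentiable_continuous; apply/derivable1_diffP; exact: derivable_horner.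
Qed.

Lemma continuous_half_trace n : continuous (half_trace n).
Proof.
by move=> x; apply: cvgM; [exact: continuous_horner_cos | exact: cvg_cst].
Qed.

Lemma continuous_wkb n : continuous (wkb n).
Proof.
move=> x; have ct := @continuous_half_trace n x.
apply: (@cvg_pair _ _ _ (nbhs x) (nbhs (wkb n x).1) (nbhs (wkb n x).2) _ _ _
  (fun y => (wkb n y).1) (fun y => (wkb n y).2)) => /=.
  apply: cvgD; apply: cvgM; try exact: continuous_horner_cos.
  by apply: cvgB => //; exact: continuous_horner_cos.
apply: cvgM; last exact: continuous_horner_cos.
apply: (@continuous_comp _ _ _ (fun x : R => 1 - half_trace n x ^+ 2) Num.sqrt).
  apply: cvgB; first exact: cvg_cst.
  exact: (cvgM ct ct).
exact: sqrt_continuous.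
Qed.

Section Segment.
Variables s t : R.
Hypotheses (s_gt0 : 0 < s) (s_le_t : s <= t) (t_lt_pi : t < pi).
Hypothesis sin_neq0 : {in `[s, t], forall x, sin (p%:R * x) != 0}.

Let sinp_continuous : continuous (fun x : R => sin (p%:R * x)).
Proof.
move=> x; apply: (@continuous_comp _ _ _ (fun x : R => p%:R * x) sin).
  by apply: cvgM; [exact: cvg_cst | exact: cvg_id].
exact: continuous_sin.
Qed.

Let in0pi x : x \in `[s, t] -> 0 < x < pi.
Proof.
by rewrite in_itv /= => /andP[sx xt]; rewrite (lt_le_trans s_gt0) // (le_lt_trans xt).
Qed.

(** The free rotation angle [acos (cos (p x))] is [p x] or [- p x] modulo [2 pi]
according to the sign of [sin (p x)], which is constant on the segment: [sg] is the
direction in which that angle moves with [x]. *)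
Lemma sin_sign : exists c sg : R,
  [/\ 0 < c <= 1, sg = 1 \/ sg = -1 &
   {in `[s, t], forall x, `|sin (p%:R * x)| = sg * sin (p%:R * x) /\
                          c <= `|sin (p%:R * x)|}].
Proof.
have [|u ust hu] := @EVT_min _ (fun x : R => `|sin (p%:R * x)|) _ _ s_le_t.
  apply: continuous_subspaceT => x; apply: cvg_norm; exact: sinp_continuous.
have sst : s \in `[s, t] by rewrite in_itv /= lexx.
exists `|sin (p%:R * u)|, (Num.sg (sin (p%:R * s))); split.
- by rewrite normr_gt0 sin_neq0 //= sin_max.
- have [|h|h] := sgrP (sin (p%:R * s)); [|by left|by right].
  by move=> /eqP; rewrite (negPf (sin_neq0 sst)).
- move=> x xst; split; last exact: hu.
  have [e|ne] := eqVneq (Num.sg (sin (p%:R * s))) (Num.sg (sin (p%:R * x))).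
    by rewrite e normrEsg.
  have sx : s <= x by move: xst; rewrite in_itv /= => /andP[].
  have [||z zsx] := @IVT _ (fun x : R => sin (p%:R * x)) s x 0 sx.
  + exact: continuous_subspaceT.
  + rewrite ge_min le_max.
    have [h|h|h] := ltgtP (sin (p%:R * s)) 0; last by move: (sin_neq0 sst); rewrite h eqxx.
      have [h'|h'|h'] := ltgtP (sin (p%:R * x)) 0 => //.
      by move: ne; rewrite (ltr0_sg h) (ltr0_sg h') eqxx.
    have [h'|h'|h'] := ltgtP (sin (p%:R * x)) 0 => //.
    by move: ne; rewrite (gtr0_sg h) (gtr0_sg h') eqxx.
  move/eqP; rewrite (negPf (sin_neq0 _)) //.
  move: zsx xst; rewrite !in_itv /= => /andP[-> zx] /andP[_ xt].
  exact: le_trans xt.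
Qed.

Lemma half_trace_unif (e : R) : 0 < e -> \forall n \near \oo,
  {in `[s, t], forall x, `|half_trace n x - cos (p%:R * x)| <= e}.
Proof.
move=> e0; have := ptame_unif tame_tr e0; apply: filterS => n hn x xst.
have sx : sin x != 0 by rewrite gt_eqF // sin_gt0_pi // in0pi.
have := hn _ (le2cos x).
rewrite [in X in _ - X]hornerD free_transfer_trace // => h.
have -> : half_trace n x - cos (p%:R * x) =
  ((al n + de n).[2 * cos x] - 2 * cos (p%:R * x)) / 2.
  by rewrite /half_trace; field.
rewrite normrM normfV normr_nat (le_trans _ h) // ler_piMr //.
by rewrite invf_le1 ?ler1n.
Qed.

Lemma is_derive_horner_cos (P : {poly R}) x :
  is_derive x 1 (fun x : R => P.[2 * cos x]) (P^`().[2 * cos x] * (2 * - sin x)).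
Proof.
have d2 : is_derive x 1 (fun x : R => 2 * cos x) (2 * - sin x).
  have := is_deriveZ 2 (is_derive_cos x).
  by [].
have h := @is_derive1_comp R (horner P) (fun x => 2 * cos x) x _ _ (is_derive_poly P _) d2.
exact: h.
Qed.

Let dhalf_trace n x := (al n + de n)^`().[2 * cos x] * - sin x.

Lemma is_derive_half_trace n x : is_derive x 1 (half_trace n) (dhalf_trace n x).
Proof.
have -> : half_trace n = fun x => (2^-1 *: (al n + de n)).[2 * cos x].
  by apply/funext => y; rewrite /half_trace hornerZ mulrC.
apply: (is_derive_eq (is_derive_horner_cos _ x)).
by rewrite derivZ hornerZ /dhalf_trace; field.
Qed.

(** The derivatives of the half traces converge to that of [cos (p x)], because
the limiting half trace is [cos (p x)] on all of [(0, pi)]. *)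
Lemma dhalf_trace_unif (e : R) : 0 < e -> \forall n \near \oo,
  {in `[s, t], forall x, `|dhalf_trace n x + p%:R * sin (p%:R * x)| <= e}.
Proof.
move=> e0; have := ptame_deriv_unif tame_tr e0; apply: filterS => n hn x xst.
have := hn _ (le2cos x); set L := (_ + _ in X in _ - X^`().[_]) => h.
have Lx : L^`().[2 * cos x] * (2 * - sin x) = - 2 * p%:R * sin (p%:R * x).
  have dL := is_derive_horner_cos L x.
  have dc : is_derive x 1 (fun x : R => 2 * cos (p%:R * x)) (- 2 * p%:R * sin (p%:R * x)).
    have dp : is_derive x 1 (fun x : R => p%:R * x) p%:R.
      by apply: is_derive_eq; rewrite /GRing.scale /= mulr1.
    have := is_deriveZ 2 (is_derive1_comp (is_derive_cos (p%:R * x)) dp).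
    by move=> d; apply: is_derive_eq; rewrite /GRing.scale /=; ring.
  have dL' : is_derive x 1 (fun x : R => L.[2 * cos x]) (- 2 * p%:R * sin (p%:R * x)).
    apply: near_eq_is_derive dc.
    have : x \in `]0, pi[ by rewrite in_itv /= in0pi.
    move=> /near_in_itvoo; apply: filterS => y; rewrite in_itv /= => y0.
    by rewrite hornerD free_transfer_trace // gt_eqF // sin_gt0_pi.
  by rewrite -(@derive_val _ _ _ _ _ _ _ dL) (@derive_val _ _ _ _ _ _ _ dL').
have -> : dhalf_trace n x + p%:R * sin (p%:R * x) =
  ((al n + de n)^`().[2 * cos x] - L^`().[2 * cos x]) * - sin x.
  by rewrite /dhalf_trace mulrBl; move: Lx; lra.
rewrite normrM (le_trans _ h) // ler_piMr // normrN; exact: sin_max.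
Qed.

Section Signed.
Variables c sg : R.
Hypotheses (c_gt0 : 0 < c) (c_le1 : c <= 1) (sg_pm1 : sg = 1 \/ sg = -1).
Hypothesis sin_sg : {in `[s, t], forall x,
  `|sin (p%:R * x)| = sg * sin (p%:R * x) /\ c <= `|sin (p%:R * x)|}.

Let sg2 : sg * sg = 1.
Proof. by case: sg_pm1 => ->; rewrite ?mulrNN mulr1. Qed.

Let sqt n x := Num.sqrt (1 - half_trace n x ^+ 2).

Lemma sqrt_unif (e : R) : 0 < e -> \forall n \near \oo,
  {in `[s, t], forall x, c / 2 <= sqt n x /\ `|sqt n x - sg * sin (p%:R * x)| <= e}.
Proof.
move=> e0.
(* [3 d] bounds the error on the squares: at most 3/4 of [c ^ 2], and at most [e * c] *)
pose d := Num.min (c ^+ 2 / 4) (e * c / 3).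
have d0 : 0 < d by rewrite lt_min !divr_gt0 ?mulr_gt0 ?exprn_gt0.
have dc : d <= c ^+ 2 / 4 by rewrite /d ge_min lexx.
have dec : d <= e * c / 3 by rewrite /d ge_min lexx orbT.
have c21 : c ^+ 2 <= 1 by rewrite expr_le1 // ltW.
have d1 : d <= 1 by lra.
have := half_trace_unif d0; apply: filterS => n hn x xst.
have [sgx cx] := sin_sg xst; have := hn _ xst.
rewrite /sqt; set u := half_trace n x; set C := cos _ => hu.
have C1 : `|C| <= 1 by exact: cos_max.
have u2 : `|u + C| <= 3.
  have -> : u + C = (u - C) + (C + C) by ring.
  rewrite (le_trans (ler_normD _ _)) //; have := ler_normD C C; lra.
have hs : `|(1 - u ^+ 2) - `|sin (p%:R * x)| ^+ 2| <= 3 * d.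
  rewrite real_normK ?num_real // sin2cos2 -/C.
  have -> : 1 - u ^+ 2 - (1 - C ^+ 2) = (u + C) * - (u - C) by ring.
  by rewrite normrM normrN ler_pM.
set S := `|sin _| in sgx cx hs *; rewrite -sgx.
have S2 : c ^+ 2 <= S ^+ 2 by rewrite ler_sqr ?nnegrE ?(ltW c_gt0) ?normr_ge0.
have h4 : c ^+ 2 / 4 <= 1 - u ^+ 2.
  by move: hs; rewrite ler_norml => /andP[]; lra.
have hq : c / 2 <= Num.sqrt (1 - u ^+ 2).
  have -> : c / 2 = Num.sqrt (c ^+ 2 / 4).
    have -> : c ^+ 2 / 4 = (c / 2) ^+ 2 by field.
    by rewrite sqrtr_sqr ger0_norm // divr_ge0 // ltW.
  by rewrite ler_wsqrtr.
split=> //; have q2 := sqr_sqrtr (le_trans (divr_ge0 (sqr_ge0 c) (ler0n _ 4)) h4).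
set q := Num.sqrt _ in hq q2 *.
have : `|q - S| * c <= 3 * d.
  apply: le_trans hs; rewrite -q2.
  have -> : q ^+ 2 - S ^+ 2 = (q - S) * (q + S) by ring.
  rewrite normrM ler_wpM2l // (le_trans _ (ler_norm _)) //.
  by move: hq cx c_gt0; lra.
by rewrite -ler_pdivlMr // => /le_trans; apply; rewrite ler_pdivrMr //; lra.
Qed.

(** An estimate of derivatives, and not only of values: it has to survive the
summation of about [n / p] angles at points at distance [1 / n]. *)
Lemma phase_lipschitz (e : R) : 0 < e -> \forall n \near \oo,
  {in `[s, t] &, forall x y,
   `|acos (half_trace n y) - acos (half_trace n x) - sg * p%:R * (y - x)|
     <= e * `|y - x|}.
Proof.
move=> e0; have p0 : 0 < p%:R :> R by rewrite ltr0n.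
have d10 : 0 < e * c / 4 by rewrite !divr_gt0 ?mulr_gt0.
have d20 : 0 < e * c / (4 * p%:R) by rewrite !divr_gt0 ?mulr_gt0.
have := dhalf_trace_unif d10; have := sqrt_unif d20.
apply: filterS2 => n hq hd.
pose f x := acos (half_trace n x) - sg * p%:R * x.
pose df x := - (sqt n x)^-1 * dhalf_trace n x - sg * p%:R.
have qgt0 x : x \in `[s, t] -> 0 < sqt n x.
  by move=> /hq[+ _]; apply: lt_le_trans; rewrite divr_gt0.
have hdf x : x \in `[s, t] -> is_derive x 1 f (df x).
  move=> xst; have q0 := qgt0 _ xst.
  have t1 : -1 < half_trace n x < 1.
    rewrite -ltr_norml -ltr_sqr ?nnegrE // expr1n real_normK ?num_real //.
    by rewrite -subr_gt0 -sqrtr_gt0.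
  have da := is_derive1_comp (is_derive1_acos t1) (is_derive_half_trace n x).
  have dl : is_derive x 1 (fun x : R => sg * p%:R * x) (sg * p%:R).
    by apply: is_derive_eq; rewrite /GRing.scale /= mulr1.
  exact: is_deriveB.
have bdf x : x \in `[s, t] -> `|df x| <= e.
  move=> xst; have q0 := qgt0 _ xst; have [cq hq'] := hq _ xst.
  have -> : df x = - (dhalf_trace n x + p%:R * sin (p%:R * x) +
       p%:R * (sg * (sqt n x - sg * sin (p%:R * x)))) / sqt n x.
    by rewrite mulrBr mulrA sg2 mul1r /df; field; rewrite gt_eqF.
  rewrite normrM normrN normfV [X in _ / X]gtr0_norm // ler_pdivrMr //.
  apply: le_trans (_ : e * (c / 2) <= _); last by rewrite ler_pM2l.
  rewrite (le_trans (ler_normD _ _)) //.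
  have -> : e * (c / 2) = e * c / 4 + p%:R * (e * c / (4 * p%:R)).
    by field; rewrite gt_eqF.
  rewrite lerD ?hd // normrM normr_nat ler_pM2l // normrM.
  have -> : `|sg| = 1 by case: sg_pm1 => ->; rewrite ?normrN normr1.
  by rewrite mul1r.
have main x y : x \in `[s, t] -> y \in `[s, t] -> x <= y ->
    `|f y - f x| <= e * `|y - x|.
  move=> xst yst xy.
  have sub z : z \in `[x, y] -> z \in `[s, t].
    move: xst yst; rewrite !in_itv /= => /andP[sx _] /andP[_ yt] /andP[xz zy].
    by rewrite (le_trans sx) ?(le_trans zy).
  have df_oo z : z \in `]x, y[ -> is_derive z 1 f (df z).
    by move=> /subset_itv_oo_cc/sub/hdf.
  have cf : {within `[x, y], continuous f}.
    apply: derivable_within_continuous => z zxy.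
    by have [] := hdf _ (sub _ zxy).
  have [z zxy ->] := MVT_segment xy df_oo cf.
  by rewrite normrM ler_wpM2r // bdf // sub.
have fE x y : acos (half_trace n y) - acos (half_trace n x) - sg * p%:R * (y - x)
   = f y - f x by rewrite /f; ring.
move=> x y xst yst; rewrite fE; have [xy|/ltW yx] := leP x y; first exact: main.
by rewrite distrC [in leRHS]distrC main.
Qed.

Lemma near_addn (P : nat -> Prop) k :
  (\forall n \near \oo, P n) -> \forall n \near \oo, P (n + k)%N.
Proof.
move=> [N _ HN]; exists N => // n /= Nn; apply: HN => /=.
by rewrite (leq_trans Nn) ?leq_addr.
Qed.

Let entry_bound U (L : {poly R}) : ptame p U L -> exists2 K : R, 0 <= K &
  \forall n \near \oo, forall x, `|(U n).[2 * cos x]| <= K.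
Proof.
move=> UL; exists (\sum_(i < size L) `|L`_i| * 2 ^+ i + 1).
  by rewrite addr_ge0 // sumr_ge0 // => i _; rewrite mulr_ge0 // exprn_ge0.
have := ptame_unif UL ltr01; apply: filterS => n hn x.
rewrite -[(U n).[_]](subrK L.[2 * cos x]) addrC (le_trans (ler_normD _ _)) //.
by rewrite lerD ?hn ?ler_norm_horner.
Qed.

Lemma frame_bounds : exists2 K : R, 0 <= K & \forall n \near \oo,
  {in `[s, t], forall x,
    [/\ c / 2 <= sqt n x, c / 2 <= `|(be n).[2 * cos x]| &
     [/\ `|(al n).[2 * cos x]| <= K, `|(be n).[2 * cos x]| <= K,
         `|(ga n).[2 * cos x]| <= K & `|(de n).[2 * cos x]| <= K]]}.
Proof.
have [K1 K10 h1] := entry_bound tame_al; have [K2 K20 h2] := entry_bound tame_be.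
have [K3 K30 h3] := entry_bound tame_ga; have [K4 K40 h4] := entry_bound tame_de.
have c20 : 0 < c / 2 by rewrite divr_gt0.
exists (K1 + K2 + (K3 + K4)); first by rewrite !addr_ge0.
have hq := sqrt_unif ltr01; have hb := ptame_unif tame_be c20.
near=> n => x xst.
have [K12 K34] : K1 + K2 <= K1 + K2 + (K3 + K4) /\ K3 + K4 <= K1 + K2 + (K3 + K4).
  by rewrite lerDl lerDr !addr_ge0.
split.
- by have [] := (near hq n _) x xst.
- have [_ cx] := sin_sg xst.
  have [hbe _] := free_transfer2 p x.
  have cb : c <= `|(TL (0, 1)).1.[2 * cos x]|.
    rewrite (le_trans cx) // -normrN -hbe normrM ler_piMl // sin_max //.
  have hbn : forall y : R, `|y| <= 2 -> `|(be n).[y] - (TL (0, 1)).1.[y]| <= c / 2.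
    by near: n.
  have := hbn _ (le2cos x).
  rewrite -/(TL _); set u := (be n).[_]; set v := _.1.[_] in cb * => uv.
  have := ler_normB u (u - v); rewrite subKr; lra.
- split.
  + by rewrite (le_trans _ K12) // (le_trans ((near h1 n _) x)) // lerDl.
  + by rewrite (le_trans _ K12) // (le_trans ((near h2 n _) x)) // lerDr.
  + by rewrite (le_trans _ K34) // (le_trans ((near h3 n _) x)) // lerDl.
  + by rewrite (le_trans _ K34) // (le_trans ((near h4 n _) x)) // lerDr.
Unshelve. all: by end_near.
Qed.

Lemma wkb_neq0 : \forall n \near \oo, {in `[s, t], forall x, wkb n x != 0}.
Proof.
have [K K0] := frame_bounds; apply: filterS => n hn x /hn[cq cb _].
have q0 : sqt n x != 0 by rewrite gt_eqF // (lt_le_trans _ cq) // divr_gt0.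
have b0 : (be n).[2 * cos x] != 0.
  by rewrite -normr_gt0 (lt_le_trans _ cb) // divr_gt0.
apply/eqP => /pair_equal_spec[/= e1 /eqP].
rewrite mulf_eq0 (negPf q0) /= => /eqP P0.
apply: (orthovec_neq0 (b := b) a_gt0 (n := n) (x := 2 * cos x)); split=> //.
move: e1; rewrite P0 mulr0 add0r => /eqP.
by rewrite mulf_eq0 (negPf b0) => /eqP.
Qed.

(** The bounded variation hypothesis enters here: over one period the solution
is rotated up to a summable relative error. *)
Lemma wkb_step : exists eps : nat -> R,
  [/\ forall n, 0 <= eps n, exists C : R, forall N, \sum_(n < N) eps n <= C &
   \forall n \near \oo, {in `[s, t], forall x,
     `|wkb (n + p) x - rotate (acos (half_trace n x)) (wkb n x)|
       <= eps n * `|wkb n x|}].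
Proof.
have [K K0 hK] := frame_bounds.
have c20 : 0 < c / 2 by rewrite divr_gt0.
have [M M0 hM] := eigencoord_drift c20 K0.
have [e1 [e10 [C1 hC1] h1]] := ptame_variation tame_tr.
have [e2 [e20 [C2 hC2] h2]] := ptame_variation tame_de.
have [e3 [e30 [C3 hC3] h3]] := ptame_variation tame_be.
exists (fun n => M * (e1 n + e2 n + e3 n)); split.
- by move=> n; rewrite mulr_ge0 // !addr_ge0.
- exists (M * (C1 + C2 + C3)) => N; rewrite -mulr_sumr !big_split /=.
  by apply: ler_wpM2l => //; exact: lerD (lerD (hC1 N) (hC2 N)) (hC3 N).
have hKp := near_addn p hK.
near=> n => x xst.
have [|cq cb [alK beK gaK deK]] := near hK n _ x xst; first by [].
have [|cq' _ _] := near hKp n _ x xst; first by [].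
have hdet : (al n).[2 * cos x] * (de n).[2 * cos x] -
            (be n).[2 * cos x] * (ga n).[2 * cos x] = 1.
  rewrite -!hornerM -hornerN -hornerD.
  have := transfer_det (A := fun i => a i.+1) (fun i => b i.+1) n p a_neq0.
  by move=> ->; rewrite hornerE.
have htr : (al n).[2 * cos x] + (de n).[2 * cos x] = 2 * half_trace n x.
  by rewrite /half_trace hornerD; field.
have {hM} := hM _ _ _ _ _ (orthopoly a b n).[2 * cos x] (orthovec a b n).2.[2 * cos x]
  (be (n + p)%N).[2 * cos x] (de (n + p)%N).[2 * cos x] (half_trace (n + p) x)
  alK beK gaK deK cb cq cq' hdet htr.
set P' := (al n).[_] * _ + _; set Q' := (ga n).[_] * _ + _.
have [-> ->] : P' = (orthopoly a b (n + p)).[2 * cos x] /\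
               Q' = (orthovec a b (n + p)).2.[2 * cos x].
  have h := transfer_orthovec a b n p.
  rewrite -[orthopoly a b (n + p)]/(orthovec a b (n + p)).1 -h.
  rewrite /P' /Q' -[orthopoly a b n]/(orthovec a b n).1.
  case: (orthovec a b n) => u v; rewrite transfer_linear /=.
  by rewrite !hornerD !hornerM.
rewrite -/(wkb n x) -/(wkb (n + p) x) => /le_trans; apply.
rewrite ler_wpM2r // ler_wpM2l // !lerD //; [|exact: h2|exact: h3].
rewrite /half_trace -mulrBl normrM (le_trans _ (h1 n _ (le2cos x))) //.
by rewrite ler_piMr // normfV normr_nat invf_le1 ?ler1n.
Unshelve. all: by end_near.
Qed.

(** The second coordinate carries the zeros of [p_n]; at a zero of [p_(n-1)] the
vector stays away from the horizontal axis. *)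
Lemma wkb_zeros : exists2 M : R, 0 <= M & \forall n \near \oo, {in `[s, t], forall x,
  (exists2 q : R, 0 < q & (wkb n x).2 = q * (orthopoly a b n).[2 * cos x]) /\
  ((orthovec a b n).2.[2 * cos x] = 0 -> `|(wkb n x).1| <= M * `|(wkb n x).2|)}.
Proof.
have c20 : 0 < c / 2 by rewrite divr_gt0.
have [K K0 hK] := frame_bounds; exists ((1 + K) * (c / 2)^-1).
  by rewrite mulr_ge0 ?addr_ge0 // invr_ge0 ltW.
move: hK; apply: filterS => n hn x xst; have [cq _ [_ _ _ deK]] := hn _ xst.
have q0 : 0 < sqt n x by exact: lt_le_trans cq.
split; first by exists (sqt n x).
move=> Q0; rewrite /wkb /eigencoord /= Q0 mulr0 addr0 !normrM -mulrA ler_pM //.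
  rewrite (le_trans (ler_normB _ _)) // lerD // ler_norml sqr_le1_itv //.
  by rewrite -[0 <= _]/(0 <= 1 - half_trace n x ^+ 2) ltW // -sqrtr_gt0.
rewrite ler_pdivlMl // ler_wpM2r // (le_trans cq) //; exact: ler_norm.
Qed.

End Signed.
End Segment.
End LocalPhase.

(** * Zeros in windows of length [pi / n] *)

Lemma opposite_signs (R : realType) (F m u v : R) : m < `|F| ->
  `|u - F| <= m -> `|v + F| <= m -> v * u < 0.
Proof.
rewrite !ler_norml => + /andP[u1 u2] /andP[v1 v2].
have [F0|F0] := ger0P F => Fm; first by rewrite nmulr_rlt0; lra.
by rewrite pmulr_rlt0; lra.
Qed.

(** The slope stays below [1 / M]: relative to [`|A|] the sine and the perturbation
contribute at most [2 * eta] to [v], while [u] keeps at least [1 - 2 * eta]. *)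
Lemma near_axis (R : realType) (M eta A C S sg u v : R) : 0 <= M ->
  eta * (4 + 4 * M) <= 1 -> `|sg| = 1 -> 0 < `|A| -> 0 <= C ->
  C ^+ 2 + S ^+ 2 = 1 -> 0 <= S -> S <= eta ->
  `|u - C * A| <= eta * `|A| -> `|v - sg * S * A| <= eta * `|A| ->
  M * `|v| < `|u|.
Proof.
move=> M0 etaM sg1 A0 C0 CS S0 Seta hu hv.
have C1 : 1 - eta <= C by nra.
have hu' : (1 - eta) * `|A| - eta * `|A| <= `|u|.
  have h1 : (1 - eta) * `|A| <= `|C * A|.
    by rewrite normrM (ger0_norm C0) ler_wpM2r.
  have := ler_normB u (u - C * A); rewrite subKr; lra.
have hv' : `|v| <= 2 * (eta * `|A|).
  have h1 : `|sg * S * A| <= eta * `|A|.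
    by rewrite !normrM sg1 mul1r (ger0_norm S0) ler_wpM2r.
  have := ler_normD (v - sg * S * A) (sg * S * A); rewrite subrK; lra.
have Mv : M * `|v| <= M * (2 * (eta * `|A|)) by rewrite ler_wpM2l.
have := ler_wpM2r (ltW A0) etaM; nra.
Qed.

Section LocalZeros.
Variables (R : realType) (a b : nat -> R) (p : nat).
Hypothesis a_gt0 : forall n, (0 < n)%N -> 0 < a n.
Hypothesis a_tame : tame p (fun n => a n.+1) 1.
Hypothesis b_tame : tame p (fun n => b n.+1) 0.
Hypothesis p_gt0 : (0 < p)%N.
Variables s t : R.
Hypotheses (s_gt0 : 0 < s) (s_le_t : s <= t) (t_lt_pi : t < pi).
Hypothesis sin_neq0 : {in `[s, t], forall x, sin (p%:R * x) != 0}.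
Implicit Types (n : nat) (x y : R).

Notation w := (wkb a b p).

(** Heine-Cantor for the finitely many possible starts [w (M + i)], relative to the
positive minima of their norms. *)
Let wkb_equicontinuous (M : nat) (e : R) : 0 < e ->
  (forall n, (M <= n)%N -> {in `[s, t], forall x, w n x != 0}) ->
  exists2 d : R, 0 < d & forall i, (i < p)%N ->
    {in `[s, t] &, forall x y, `|y - x| < d ->
      `|w (M + i) y - w (M + i) x| <= e * `|w (M + i) x|}.
Proof.
move=> e0 w0.
have /choice[d hd] : forall i : 'I_p, exists d : R, 0 < d /\
    {in `[s, t] &, forall x y, `|y - x| < d ->
      `|w (M + i) y - w (M + i) x| <= e * `|w (M + i) x|}.
  move=> i; have cw := @continuous_wkb _ a b p (M + i).
  have [|u ust hu] := @EVT_min _ (fun x => `|w (M + i) x|) _ _ s_le_t.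
    by apply: continuous_subspaceT => x; apply: cvg_norm; exact: cw.
  have m0 : 0 < e * `|w (M + i) u|.
    by rewrite mulr_gt0 // normr_gt0 w0 // leq_addr.
  have [|d d0 hd] := @segment_unif_continuous _ _ (w (M + i)) s t _ _ m0.
    by move=> x _; exact: cw.
  exists d; split => // x y xst yst xy.
  apply: ltW; apply: lt_le_trans (hd _ _ yst xst xy) _.
  by rewrite ler_pM2l // hu.
exists (\big[Num.min/1]_(i < p) d i).
  elim/big_ind: _ => // [x y x0 y0|i _]; first by rewrite lt_min x0.
  by have [] := hd i.
move=> i ip x y xst yst xy.
have [_] := hd (Ordinal ip); apply=> //.
by apply: lt_le_trans xy _; exact: (bigmin_le _ (Ordinal ip)).
Qed.

Section Signed.
Variables c sg : R.
Hypotheses (c_gt0 : 0 < c) (c_le1 : c <= 1) (sg_pm1 : sg = 1 \/ sg = -1).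
Hypothesis sin_sg : {in `[s, t], forall x,
  `|sin (p%:R * x)| = sg * sin (p%:R * x) /\ c <= `|sin (p%:R * x)|}.

Let near_exists (P : nat -> Prop) :
  (\forall n \near \oo, P n) -> exists N, forall n, (N <= n)%N -> P n.
Proof. by move=> [N _ HN]; exists N => n Nn; exact: HN. Qed.

(** On the scale [1 / n] of the spacing of the zeros, moving the angle [x] by [h]
just rotates [w n x] by [n * h]. Start both orbits at an index [M] beyond which
the relative errors sum to little; there [w M] is continuous, so the starting
points agree, and the phases accumulated up to [n] differ by [n * h] up to the
Lipschitz error and the at most [M + p] steps before the start. *)
Lemma wkb_local (eta L : R) : 0 < eta -> 0 < L -> \forall n \near \oo,
  {in `[s, t] &, forall x y, n%:R * `|y - x| <= L ->
   `|w n y - rotate (sg * (n%:R * (y - x))) (w n x)| <= eta * `|w n x|}.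
Proof.
move=> eta0 L0; have [e [e0 e16 e272]] : exists e : R, [/\ 0 < e, e <= 16^-1 & 272 * e <= eta].
  have h : 0 < eta / 272 by apply: divr_gt0 eta0 _; rewrite ltr0n.
  exists (Num.min 16^-1 (eta / 272)); split.
  - by rewrite lt_min h invr_gt0 ltr0n.
  - by rewrite ge_min lexx.
  - by rewrite mulrC -ler_pdivlMr ?ltr0n // ge_min lexx orbT.
have e10 : 0 < e / 2 / L by rewrite !divr_gt0.
have [eps [eps0 [C hC] hstep]] :=
  wkb_step a_gt0 a_tame b_tame s_gt0 t_lt_pi c_gt0 c_le1 sin_sg.
have hphase := phase_lipschitz a_gt0 a_tame b_tame p_gt0 s_gt0 t_lt_pi c_gt0 c_le1
  sg_pm1 sin_sg e10.
have hw0 := wkb_neq0 a_gt0 a_tame b_tame s_gt0 t_lt_pi c_gt0 c_le1 sin_sg.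
have htail := sum_tail_small eps0 hC e0.
have [M hM] := near_exists (filterI (filterI hstep hphase) (filterI hw0 htail)).
have {hstep} Hstep n : (M <= n)%N -> _ := fun Mn => (hM n Mn).1.1.
have {hphase} Hphase n : (M <= n)%N -> _ := fun Mn => (hM n Mn).1.2.
have {hw0} Hw0 n : (M <= n)%N -> _ := fun Mn => (hM n Mn).2.1.
have {htail} Htail := (hM M (leqnn M)).2.2.
have [d d0 hd] := wkb_equicontinuous e0 Hw0.
have h1 := nbhs_infty_ger (L / d + 1); have h2 := nbhs_infty_ger (2 * (M + p)%:R * L / e).
have h3 : \forall n \near \oo, (M <= n)%N by exists M.
near=> n => x y xst yst xyL.
have n0 : 0 < n%:R :> R.
  apply: lt_le_trans (_ : L / d + 1 <= _); last by near: n.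
  by rewrite ltr_wpDl // divr_ge0 // ltW.
have Mn : (M <= n)%N by near: n.
pose i := ((n - M) %% p)%N; pose k := ((n - M) %/ p)%N.
have ip : (i < p)%N by rewrite ltn_mod.
have En : n = (M + i + k * p)%N.
  by rewrite -addnA [(i + _)%N]addnC -divn_eq subnKC.
have xyLn : `|y - x| <= L / n%:R by rewrite ler_pdivlMr // mulrC.
have xyd : `|y - x| < d.
  apply: le_lt_trans xyLn _; rewrite ltr_pdivrMr // mulrC -ltr_pdivrMr //.
  apply: lt_le_trans (_ : L / d + 1 <= _); first by rewrite ltrDl.
  by near: n.
have Mj j : (M <= M + i + j * p)%N by rewrite -addnA leq_addr.
have /= := @rotate_orbit_compare R (fun j => w (M + i + j * p) y)
  (fun j => w (M + i + j * p) x)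
  (fun j => acos (half_trace a b p (M + i + j * p) y))
  (fun j => acos (half_trace a b p (M + i + j * p) x))
  (fun j => eps (M + i + j * p)%N) e (sg * (n%:R * (y - x))) k e16.
rewrite -En mul0n addn0 => H.
apply: le_trans (H _ _ _ _ _ _) _ => {H}.
- by move=> j; exact: eps0.
- apply: le_trans (sum_stride_le _ _ p_gt0 eps0) _; rewrite -En.
  apply: le_trans (Htail n); rewrite [leRHS](@big_cat_nat _ _ _ (M + i)) ?leq_addr //=.
    by rewrite lerDr sumr_ge0.
  by rewrite [leqRHS]En leq_addr.
- move=> j _; have := Hstep _ (Mj j) _ yst.
  by rewrite -addnA [(j * p + p)%N]addnC -mulSn.
- move=> j _; have := Hstep _ (Mj j) _ xst.
  by rewrite -addnA [(j * p + p)%N]addnC -mulSn.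
- exact: hd.
- have -> : \sum_(j < k) acos (half_trace a b p (M + i + j * p) y) -
      \sum_(j < k) acos (half_trace a b p (M + i + j * p) x) - sg * (n%:R * (y - x)) =
    \sum_(j < k) (acos (half_trace a b p (M + i + j * p) y) -
      acos (half_trace a b p (M + i + j * p) x) - sg * p%:R * (y - x))
      - sg * (M + i)%:R * (y - x).
    rewrite !sumrB sumr_const card_ord {1}En natrD natrM -mulr_natl; ring.
  rewrite [e]splitr (le_trans (ler_normB _ _)) // lerD //.
    rewrite (le_trans (ler_norm_sum _ _ _)) //.
    apply: le_trans (_ : \sum_(j < k) (e / 2 / L * `|y - x|) <= _).
      by apply: ler_sum => j _; exact: Hphase.
    rewrite sumr_const card_ord -[leLHS]mulr_natl.
    have -> : k%:R * (e / 2 / L * `|y - x|) = e / 2 * (k%:R * `|y - x| / L) by ring.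
    rewrite ler_piMr ?divr_ge0 ?(ltW e0) // ler_pdivrMr // mul1r.
    rewrite (le_trans _ xyL) // ler_wpM2r // ler_nat.
    by rewrite [leqRHS]En (leq_trans _ (leq_addl _ _)) // leq_pmulr.
  rewrite !normrM (_ : `|sg| = 1); last by case: sg_pm1 => ->; rewrite ?normrN normr1.
  rewrite mul1r normr_nat.
  apply: le_trans (_ : (M + p)%:R * (L / n%:R) <= _).
    by rewrite ler_pM // ler_nat leq_add2l ltnW.
  rewrite mulrA ler_pdivrMr // [leRHS]mulrC -ler_pdivrMr ?divr_gt0 //.
  have -> : (M + p)%:R * L / (e / 2) = 2 * (M + p)%:R * L / e.
    by field; rewrite gt_eqF.
  by near: n.
- exact: ler_wpM2r.
Unshelve. all: by end_near.
Qed.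

Let sg_abs : `|sg| = 1.
Proof. by case: sg_pm1 => ->; rewrite ?normrN normr1. Qed.

Let sg2 : sg * sg = 1.
Proof. by case: sg_pm1 => ->; rewrite ?mulrNN mulr1. Qed.

Let sin_sgM (h : R) : sin (sg * h) = sg * sin h.
Proof. by case: sg_pm1 => ->; rewrite ?mulN1r ?sinN ?mul1r. Qed.

Let cos_sgM (h : R) : cos (sg * h) = cos h.
Proof. by case: sg_pm1 => ->; rewrite ?mulN1r ?cosN ?mul1r. Qed.

(** [p_n] is the second coordinate of [w n] up to a positive factor. Rotating by
[pi] reverses its sign, which gives a zero as soon as it is not too small compared
with [w n x]; if it is, first rotate by a small angle [k]. *)
Lemma zero_within (e : R) : 0 < e -> \forall n \near \oo, forall x,
  x \in `[s, t] -> x + (pi + e) / n%:R \in `[s, t] ->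
  exists2 E : R, 2 * cos (x + (pi + e) / n%:R) < E < 2 * cos x &
    root (orthopoly a b n) E.
Proof.
move=> e_gt0; have [k [k0 ke k1]] : exists k : R, [/\ 0 < k, k <= e & k <= 1].
  by exists (Num.min e 1); rewrite lt_min e_gt0 ltr01 !ge_min !lexx orbT.
have pi2 : 2 <= pi :> R := pi_ge2 R.
have sk : 0 < sin k by rewrite sin_gt0_pi // k0 /=; lra.
have [eta eta0 eta4] : exists2 eta : R, 0 < eta & 4 * eta = sin k.
  by exists (sin k / 4); [rewrite divr_gt0 | field].
have L0 : 0 < pi + 1 :> R by lra.
have hloc := wkb_local eta0 L0.
have hw0 := wkb_neq0 a_gt0 a_tame b_tame s_gt0 t_lt_pi c_gt0 c_le1 sin_sg.
have [M M0 hz] := wkb_zeros a_gt0 a_tame b_tame s_gt0 t_lt_pi c_gt0 c_le1 sin_sg.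
have hn0 : \forall n \near \oo, (0 < n)%N by exists 1.
near=> n => x xst yst.
have n0 : 0 < n%:R :> R by rewrite ltr0n; near: n.
have Wn : {in `[s, t], forall x, w n x != 0} by near: n.
have wx0 : 0 < `|w n x| by rewrite normr_gt0 Wn.
set A := (w n x).1; set B := (w n x).2.
pose F h := sg * sin h * A + cos h * B.
have inst h : 0 <= h <= pi + k -> x + h / n%:R \in `[s, t].
  move=> /andP[h0 hk]; move: xst yst; rewrite !in_itv /= => /andP[sx _] /andP[_ yt].
  rewrite (le_trans sx) ?lerDl ?divr_ge0 //= (le_trans _ yt) // lerD2l.
  by rewrite ler_pM2r ?invr_gt0 // (le_trans hk) // lerD2l.
have hF h : 0 <= h <= pi + k -> `|(w n (x + h / n%:R)).2 - F h| <= eta * `|w n x|.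
  move=> h0k; have hin := inst _ h0k; have /andP[h0 hk] := h0k.
  have hh : n%:R * (x + h / n%:R - x) = h by field; rewrite gt_eqF.
  have Hn : {in `[s, t] &, forall x y, n%:R * `|y - x| <= pi + 1 ->
   `|w n y - rotate (sg * (n%:R * (y - x))) (w n x)| <= eta * `|w n x|} by near: n.
  have := Hn _ _ xst hin; rewrite hh.
  have -> : n%:R * `|x + h / n%:R - x| = h.
    by rewrite -{1}(gtr0_norm n0) -normrM hh ger0_norm.
  move=> /(_ (le_trans hk _))/(le_trans (norm_snd_le _)).
  by rewrite /= sin_sgM cos_sgM; apply; rewrite lerD2l.
have Fpi h : F (h + pi) = - F h by rewrite /F sinDpi cosDpi; ring.
have Zn : {in `[s, t], forall x,
    (exists2 q : R, 0 < q & (w n x).2 = q * (orthopoly a b n).[2 * cos x]) /\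
    ((orthovec a b n).2.[2 * cos x] = 0 -> `|(w n x).1| <= M * `|(w n x).2|)}.
  by near: n.
have itv y : y \in `[s, t] -> 0 <= y <= pi.
  rewrite in_itv /= => /andP[sy yt].
  by rewrite (le_trans (ltW s_gt0) sy) (le_trans yt (ltW t_lt_pi)).
have sign_change h : 0 <= h <= k -> eta * `|w n x| < `|F h| ->
    exists2 E : R, 2 * cos (x + (pi + e) / n%:R) < E < 2 * cos x &
    root (orthopoly a b n) E.
  move=> /andP[h0 hk] Fh.
  have i1 : 0 <= h <= pi + k by rewrite h0 /=; lra.
  have i2 : 0 <= h + pi <= pi + k by apply/andP; split; lra.
  have [st1 st2] := (inst _ i1, inst _ i2).
  have [[q1 q10 e1] _] := Zn _ st1; have [[q2 q20 e2] _] := Zn _ st2.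
  have b1 := hF _ i1.
  have b2' := hF _ i2; rewrite Fpi opprK in b2'.
  have prod : (orthopoly a b n).[2 * cos (x + (h + pi) / n%:R)] *
              (orthopoly a b n).[2 * cos (x + h / n%:R)] < 0.
    rewrite -(pmulr_rlt0 _ q10) -(pmulr_rlt0 _ q20).
    have -> : forall u v : R, q2 * (q1 * (u * v)) = (q2 * u) * (q1 * v).
      by move=> u v; ring.
    by rewrite -e1 -e2; apply: opposite_signs Fh b1 b2'.
  have n1 : 0 <= n%:R^-1 :> R by rewrite invr_ge0 ltW.
  have /andP[x0 xpi] := itv _ xst; have /andP[y0 ypi] := itv _ yst.
  have /andP[z0 zpi] := itv _ st1; have /andP[z0' zpi'] := itv _ st2.
  have cc : 2 * cos (x + (h + pi) / n%:R) <= 2 * cos (x + h / n%:R).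
    by rewrite ler_pM2l // ler_cos // lerD2l ler_wpM2r // lerDl pi_ge0.
  have [E] := poly_ivtoo cc prod; rewrite in_itv /= => /andP[E1 E2] rE.
  exists E => //; apply/andP; split.
    apply: le_lt_trans E1; rewrite ler_pM2l // ler_cos // lerD2l ler_wpM2r //.
    by rewrite addrC lerD2l (le_trans hk).
  apply: lt_le_trans E2 _; rewrite ler_pM2l // ler_cos // lerDl divr_ge0 // ltW.
have [hB|hB] := ltP (eta * `|w n x|) `|B|.
  apply: (sign_change 0); first by rewrite lexx ltW.
  by rewrite /F sin0 cos0 mulr0 mul0r add0r mul1r.
apply: (sign_change k); first by rewrite lexx ltW.
have sk1 : sin k <= 1 by exact: sin_le1.
have eta1 : eta < 1 by lra.
have wA : `|w n x| = `|A|.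
  apply/eqP; rewrite eq_le norm_fst_le andbT prod_normE ge_max lexx /=.
  rewrite leNgt; apply/negP => AB; move: hB; rewrite leNgt => /negP; apply.
  have -> : `|w n x| = `|B| by rewrite prod_normE; apply/max_idPr/ltW.
  by rewrite gtr_pMl // (le_lt_trans _ AB).
rewrite wA in hB *.
have h1 : `|sin k * A| <= `|F k| + `|B|.
  have -> : sin k * A = sg * (F k - cos k * B).
    by rewrite /F addrK !mulrA sg2 mul1r.
  rewrite normrM sg_abs mul1r (le_trans (ler_normB _ _)) // lerD // normrM.
  by rewrite ler_piMl // cos_max.
rewrite normrM (gtr0_norm sk) in h1.
have A0 : 0 < `|A| by rewrite -wA.
have : 0 < eta * `|A| by rewrite mulr_gt0.
have : sin k * `|A| = 4 * (eta * `|A|) by rewrite mulrA eta4.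
move: h1 hB; lra.
Unshelve. all: by end_near.
Qed.

(** Two zeros closer than [(pi - e) / n] would be at a distance [o(1 / n)], since
the rotating vector is horizontal only at multiples of [pi]. The vector would then
stay nearly horizontal in between, which contradicts the zero of [p_(n-1)] there. *)
Lemma zeros_apart (e : R) : 0 < e -> \forall n \near \oo,
  {in `[s, t] &, forall x y, x < y ->
    root (orthopoly a b n) (2 * cos x) -> root (orthopoly a b n) (2 * cos y) ->
    pi - e <= n%:R * (y - x)}.
Proof.
move=> e_gt0; have [k [k0 ke k1]] : exists k : R, [/\ 0 < k, k <= e & k <= 1].
  by exists (Num.min e 1); rewrite lt_min e_gt0 ltr01 !ge_min !lexx orbT.
have pi2 : 2 <= pi :> R := pi_ge2 R.
have sk : 0 < sin k by rewrite sin_gt0_pi // k0 /=; lra.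
have [M M0 hz] := wkb_zeros a_gt0 a_tame b_tame s_gt0 t_lt_pi c_gt0 c_le1 sin_sg.
have M4 : 0 < 4 + 4 * M by lra.
have [eta [eta0 etak etaM]] : exists eta : R,
    [/\ 0 < eta, eta <= sin k / 2 & eta * (4 + 4 * M) <= 1].
  exists (Num.min (sin k / 2) (4 + 4 * M)^-1); split.
  - by rewrite lt_min divr_gt0 // invr_gt0.
  - by rewrite ge_min lexx.
  - by rewrite -ler_pdivlMr // mul1r ge_min lexx orbT.
have L0 : 0 < pi + 1 :> R by lra.
have hloc := wkb_local eta0 L0.
have hw0 := wkb_neq0 a_gt0 a_tame b_tame s_gt0 t_lt_pi c_gt0 c_le1 sin_sg.
have hn0 : \forall n \near \oo, (0 < n)%N by exists 1.
near=> n => x y xst yst xy rx ry.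
have n0 : 0 < n%:R :> R by rewrite ltr0n; near: n.
have Wn : {in `[s, t], forall x, w n x != 0} by near: n.
have Zn : {in `[s, t], forall x,
    (exists2 q : R, 0 < q & (w n x).2 = q * (orthopoly a b n).[2 * cos x]) /\
    ((orthovec a b n).2.[2 * cos x] = 0 -> `|(w n x).1| <= M * `|(w n x).2|)}.
  by near: n.
have Hn : {in `[s, t] &, forall x y, n%:R * `|y - x| <= pi + 1 ->
   `|w n y - rotate (sg * (n%:R * (y - x))) (w n x)| <= eta * `|w n x|} by near: n.
rewrite leNgt; apply/negP => hlt; set h := n%:R * (y - x) in hlt.
have h0 : 0 < h by rewrite mulr_gt0 // subr_gt0.
have [sx xt] : s <= x /\ x <= t by move: xst; rewrite in_itv => /andP.
have [sy yt] : s <= y /\ y <= t by move: yst; rewrite in_itv => /andP.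
set A := (w n x).1.
have B0 : (w n x).2 = 0.
  by have [[q _ ->] _] := Zn _ xst; rewrite (rootP rx) mulr0.
have wA : `|w n x| = `|A|.
  by rewrite prod_normE B0 normr0; apply/max_idPl.
have A0 : 0 < `|A| by rewrite -wA normr_gt0 Wn.
(* positions relative to [x], in the frame of [w n x] *)
have near_x z : x <= z -> z <= y ->
    `|(w n z).1 - cos (n%:R * (z - x)) * A| <= eta * `|A| /\
    `|(w n z).2 - sg * sin (n%:R * (z - x)) * A| <= eta * `|A|.
  move=> xz zy; have zst : z \in `[s, t].
    by rewrite in_itv /= (le_trans sx xz) (le_trans zy yt).
  have := Hn _ _ xst zst; rewrite wA (ger0_norm (_ : 0 <= z - x)) ?subr_ge0 //.
  have hz1 : n%:R * (z - x) <= pi + 1.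
    apply: le_trans (_ : h <= _); first by rewrite ler_pM2l // lerD2r.
    by rewrite ltW // (lt_trans hlt) //; lra.
  move=> /(_ hz1).
  have -> : rotate (sg * (n%:R * (z - x))) (w n x) =
      (cos (n%:R * (z - x)) * A, sg * sin (n%:R * (z - x)) * A).
    by rewrite /rotate B0 !mulr0 subr0 addr0 sin_sgM cos_sgM.
  by rewrite norm_pair_le => /andP[].
have sin_h : sin h <= eta.
  have [_] := near_x _ (ltW xy) (lexx y).
  have [[q _ ->] _] := Zn _ yst; rewrite (rootP ry) mulr0 sub0r normrN -/h.
  rewrite !normrM sg_abs mul1r ler_pM2r // => hs; exact: le_trans (ler_norm _) hs.
have h_small : h <= pi / 2.
  rewrite leNgt; apply/negP => hbig.
  suff : sin k < sin h by lra.
  have -> : sin h = sin (pi - h) by rewrite sinB sinpi cospi mul0r sub0r mulN1r opprK.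
  have h_in : pi - h \in `[- (pi / 2), pi / 2].
    rewrite in_itv /= lerBlDr lerBrDr; lra.
  have k_in : k \in `[- (pi / 2), pi / 2].
    rewrite in_itv /= (le_trans _ (ltW k0)) ?oppr_le0 ?divr_ge0 ?pi_ge0 //=.
    by rewrite (le_trans k1) ?pihalf_ge1.
  by rewrite ltr_sin // ltrBrDr -ltrBrDl (lt_le_trans hlt) // lerD2l lerN2.
have zh : exists2 z, x <= z <= y & (orthovec a b n).2.[2 * cos z] = 0.
  have cxy : 2 * cos y < 2 * cos x.
    have x_in : x \in `[0, pi].
      by rewrite in_itv /= (le_trans (ltW s_gt0) sx) (le_trans xt (ltW t_lt_pi)).
    have y_in : y \in `[0, pi].
      by rewrite in_itv /= (le_trans (ltW s_gt0) sy) (le_trans yt (ltW t_lt_pi)).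
    by rewrite ltr_pM2l // ltr_cos.
  have [E /andP[E1 E2] QE] := orthopoly_interlace a_gt0 cxy ry rx.
  have xy' := ltW xy.
  have cc : {within `[x, y], continuous (fun z : R => 2 * cos z)}.
    apply: continuous_subspaceT => z.
    by apply: cvgM; [exact: cvg_cst | exact: continuous_cos].
  have [|z zxy Ez] := @IVT _ (fun z : R => 2 * cos z) x y E xy' cc.
    by rewrite ge_min le_max E1 E2 orbT.
  by exists z; rewrite ?Ez.
have [z /andP[xz zy] Qz] := zh.
have zst : z \in `[s, t] by rewrite in_itv /= (le_trans sx xz) (le_trans zy yt).
have [_ /(_ Qz)] := Zn _ zst; have [] := near_x _ xz zy.
set h' := n%:R * (z - x); have h'h : h' <= h by rewrite ler_pM2l // lerD2r.
have h'0 : 0 <= h' by rewrite mulr_ge0 ?subr_ge0 // ltW.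
have s'h : sin h' <= eta.
  have in_h u : 0 <= u -> u <= h -> u \in `[- (pi / 2), pi / 2].
    move=> u0 uh; rewrite in_itv /= (le_trans uh h_small) andbT.
    by rewrite (le_trans _ u0) // oppr_le0 divr_ge0 // pi_ge0.
  by apply: le_trans sin_h; rewrite leNgt ltr_sin ?in_h ?lexx ?(ltW h0) // -leNgt.
have s'0 : 0 <= sin h'.
  rewrite sin_ge0_pi // h'0 /= (le_trans h'h) // (le_trans h_small) //.
  by rewrite ler_piMr ?pi_ge0 // invf_le1 ?ltr0n ?ler1n.
have c'0 : 0 <= cos h'.
  rewrite cos_ge0_pihalf // (le_trans h'h h_small) andbT.
  by rewrite (le_trans _ h'0) // oppr_le0 divr_ge0 ?pi_ge0.
move=> hu hv; apply/negP; rewrite -ltNge.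
exact: near_axis M0 etaM sg_abs A0 c'0 (cos2Dsin2 h') s'0 s'h hu hv.
Unshelve. all: by end_near.
Qed.

End Signed.
End LocalZeros.

(** * The arcsine law *)

Section Arcsine.
Variable R : realType.
Implicit Types (x y u v : R).
Notation mu := (@lebesgue_measure R).

(** Outside [(-2, 2)] the square root is 0, hence so is its inverse. *)
Definition arcsine_density x : R := (pi * Num.sqrt (4 - x ^+ 2))^-1.

Lemma arcsine_density_ge0 x : 0 <= arcsine_density x.
Proof. by rewrite invr_ge0 mulr_ge0 ?pi_ge0. Qed.

Lemma arcsine_density_out x : x \notin `]-2, 2[ -> arcsine_density x = 0.
Proof.
rewrite in_itv /= -ltr_norml -leNgt => x2; rewrite /arcsine_density ler0_sqrtr.
  by rewrite mulr0 invr0.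
rewrite subr_le0 -[x ^+ 2]real_normK ?num_real //.
have -> : 4 = 2 ^+ 2 :> R by ring.
by rewrite ler_sqr ?nnegrE.
Qed.

Let sqrt_gt0 x : x \in `]-2, 2[ -> 0 < pi * Num.sqrt (4 - x ^+ 2).
Proof.
rewrite in_itv /= -ltr_norml => x2; rewrite mulr_gt0 ?pi_gt0 // sqrtr_gt0 subr_gt0.
rewrite -[x ^+ 2]real_normK ?num_real //; have -> : 4 = 2 ^+ 2 :> R by ring.
by rewrite ltr_sqr ?nnegrE.
Qed.

Lemma arcsine_density_gt0 x : x \in `]-2, 2[ -> 0 < arcsine_density x.
Proof. by move=> /sqrt_gt0; rewrite invr_gt0. Qed.

Lemma continuous_arcsine_density x : x \in `]-2, 2[ ->
  {for x, continuous arcsine_density}.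
Proof.
move=> x2; apply: cvgV; first by rewrite gt_eqF ?sqrt_gt0.
apply: cvgM; first exact: cvg_cst.
apply: (@continuous_comp _ _ _ (fun x : R => 4 - x ^+ 2) Num.sqrt).
  apply: cvgB; first exact: cvg_cst.
  apply: cvgM; exact: cvg_id.
exact: sqrt_continuous.
Qed.

Lemma measurable_arcsine_density (D : set R) : measurable_fun D arcsine_density.
Proof.
apply: measurable_funTS.
have -> : arcsine_density = arcsine_density \_ `]-2, 2[.
  apply/funext => x; rewrite patchE; case: ifPn => // x2.
  by rewrite arcsine_density_out //; apply: contra x2 => h; rewrite inE.
apply: (measurable_restrictT _ _).1; first exact: measurable_itv.
apply: open_continuous_measurable_fun; first exact: interval_open.
by move=> x; rewrite inE; exact: continuous_arcsine_density.
Qed.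

Let emeasurable (D : set R) : measurable_fun D (fun x => (arcsine_density x)%:E).
Proof. by apply/measurable_EFinP; exact: measurable_arcsine_density. Qed.

Definition arcsine_prob (A : set (measurableTypeR R)) : \bar R :=
  (\int[mu]_(x in A) (arcsine_density x)%:E)%E.

Let arcsine0 : arcsine_prob set0 = 0%E.
Proof. by rewrite /arcsine_prob integral_set0. Qed.

Let arcsine_ge0 A : (0 <= arcsine_prob A)%E.
Proof. by apply: integral_ge0 => x _; rewrite lee_fin arcsine_density_ge0. Qed.

Let arcsine_sigma_additive : semi_sigma_additive arcsine_prob.
Proof.
move=> /= A mA tA mUA; rewrite /arcsine_prob ge0_integral_bigcup //.
  by apply: is_cvg_ereal_nneg_natsum_cond => n _ _; exact: arcsine_ge0.
  exact: emeasurable.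
by move=> x _; rewrite lee_fin arcsine_density_ge0.
Qed.

HB.instance Definition _ := isMeasure.Build _ _ _
  arcsine_prob arcsine0 arcsine_ge0 arcsine_sigma_additive.

(** In the variable [2 cos x] the arcsine law is the uniform law of the angle. *)
Lemma arcsine_prob_cc u v : 0 < u -> u < v -> v < pi ->
  arcsine_prob `[2 * cos v, 2 * cos u] = ((v - u) / pi)%:E.
Proof.
move=> u0 uv vpi.
have hu : u \in `[0, pi] by rewrite in_itv /= (ltW u0) ltW // (lt_trans uv).
have hv : v \in `[0, pi] by rewrite in_itv /= (ltW vpi) ltW // (lt_trans u0).
have cuv : 2 * cos v < 2 * cos u by rewrite ltr_pM2l // ltr_cos.
have sub x : x \in `[2 * cos v, 2 * cos u] -> x \in `]-2, 2[.
  have : 2 * cos u \in `]-2, 2[ by rewrite two_cos_itv // u0 (lt_trans uv).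
  have : 2 * cos v \in `]-2, 2[ by rewrite two_cos_itv // vpi (lt_trans u0).
  rewrite !in_itv /= => /andP[a1 a2] /andP[b1 b2] /andP[x1 x2].
  by apply/andP; split; lra.
(* the distribution function up to a constant *)
pose F x : R := - pi^-1 * acos (2^-1 * x).
have dF x : x \in `[2 * cos v, 2 * cos u] -> is_derive x 1 F (arcsine_density x).
  move=> /sub x2; have x1 : -1 < 2^-1 * x < 1.
    by move: x2; rewrite in_itv /= => /andP[]; lra.
  have dx : is_derive x 1 (fun x : R => 2^-1 * x) (2^-1).
    by apply: is_derive_eq; rewrite /GRing.scale /= mulr1.
  have da := is_derive1_comp (is_derive1_acos x1) dx.
  have dF := is_deriveZ (- pi^-1 : R) da.
  apply: (is_derive_eq dF).
  have -> : 1 - (2^-1 * x) ^+ 2 = (4 - x ^+ 2) / 2 ^+ 2 by field.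
  have s0 := sqrt_gt0 x2.
  have s1 : Num.sqrt (4 - x ^+ 2) != 0.
    by apply/eqP => e; move: s0; rewrite e mulr0 ltxx.
  rewrite sqrtrM; last by rewrite ltW // -sqrtr_gt0 lt0r s1 sqrtr_ge0.
  rewrite -exprVn sqrtr_sqr ger0_norm ?invr_ge0 //.
  rewrite /arcsine_density /GRing.scale /=.
  by move: pi (pi_gt0 R) => P P0; field; rewrite s1 gt_eqF.
have cF : {within `[2 * cos v, 2 * cos u], continuous F}.
  by apply: derivable_within_continuous => x /dF[].
have [oF cR cL] : derivable_oo_LRcontinuous F (2 * cos v) (2 * cos u).
  have [_ h1 h2] := (continuous_within_itvP F cuv).1 cF.
  by split => // x /subset_itv_oo_cc/dF[].
rewrite /arcsine_prob (@continuous_FTC2 _ _ F) //.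
- by rewrite -EFinB /F !mulKf // !cosK //; congr EFin; ring.
- by apply: continuous_in_subspaceT => x; rewrite inE => /sub/continuous_arcsine_density.
- by move=> x /subset_itv_oo_cc/dF d; rewrite derive1E (@derive_val _ _ _ _ _ _ _ d).
Qed.

(** Exhaustion by closed intervals extends the formula to the end points of the
spectrum, where the density is unbounded. *)
Lemma arcsine_prob_oo u v : 0 <= u -> u < v -> v <= pi ->
  arcsine_prob `]2 * cos v, 2 * cos u[ = ((v - u) / pi)%:E.
Proof.
move=> u0 uv vpi; pose d n : R := (v - u) / n.+3%:R.
have d0 n : 0 < d n by rewrite divr_gt0 // subr_gt0.
have d3 n : d n <= (v - u) / 3.
  by rewrite ler_pM2l ?subr_gt0 // lef_pV2 ?posrE // ler_nat.
have dn n m : (n <= m)%N -> d m <= d n.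
  by move=> nm; rewrite ler_pM2l ?subr_gt0 // lef_pV2 ?posrE // ler_nat.
have dcvg : d n @[n --> \oo] --> (0 : R).
  rewrite -(mulr0 (v - u)); apply: cvgM; first exact: cvg_cst.
  have := @cvg_harmonic R; rewrite -(cvg_shiftn 2) /=.
  by under eq_fun do rewrite addn2.
pose F n := `[2 * cos (v - d n), 2 * cos (u + d n)]%classic : set (measurableTypeR R).
have lt_cos x y : 0 <= x -> x < y -> y <= pi -> cos y < cos x.
  move=> x0 xy ypi; have [y0 xpi] := (le_trans x0 (ltW xy), le_trans (ltW xy) ypi).
  by rewrite ltr_cos ?in_itv /= ?x0 ?y0 ?xpi ?ypi.
have UF : \bigcup_n F n = `]2 * cos v, 2 * cos u[%classic.
  apply/seteqP; split => x /=.
    move=> [n _]; rewrite /F /= !in_itv /= => /andP[x1 x2].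
    have [a1 a2] := (d0 n, d3 n); apply/andP; split.
      by apply: lt_le_trans x1; rewrite ltr_pM2l // lt_cos //; lra.
    by apply: le_lt_trans x2 _; rewrite ltr_pM2l // lt_cos //; lra.
  rewrite in_itv /= => /andP[x1 x2].
  have [|y /andP[y0 ypi] xy] := @two_cos_surj _ x.
    by have := cos_geN1 v; have := cos_le1 u => b1 b2; apply/andP; split; lra.
  have uy : u < y.
    by rewrite ltNge; apply/negP => yu; have := ler_cos y0 yu (ltW (lt_le_trans uv vpi)); lra.
  have yv : y < v.
    by rewrite ltNge; apply/negP => vy; have := ler_cos (le_trans u0 (ltW uv)) vy ypi; lra.
  have [N _ HN] : \forall n \near \oo, d n < Num.min (y - u) (v - y).
    by apply: (cvgr_lt _ dcvg); rewrite lt_min !subr_gt0 uy yv.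
  have := HN N (leqnn N); rewrite /= lt_min => /andP[h1 h2].
  have a1 := d0 N; exists N => //; rewrite /F /= in_itv /= xy !ler_pM2l //.
  by rewrite !ler_cos //; lra.
have mF n : measurable (F n) by exact: measurable_itv.
have ndF : {homo F : n m / (n <= m)%N >-> (n <= m)%O}.
  move=> n m nm; apply/subsetPset => x; rewrite /F /= !in_itv /= => /andP[x1 x2].
  have [[a1 a2] a3] := (d0 m, d3 n, dn _ _ nm); apply/andP; split.
    by apply: le_trans x1; rewrite ler_pM2l // ler_cos //; lra.
  by apply: le_trans x2 _; rewrite ler_pM2l // ler_cos //; lra.
have mUF : measurable (\bigcup_n F n) by exact: bigcup_measurable.
have h1 := nondecreasing_cvg_mu (mu := arcsine_prob) mF mUF ndF.
rewrite UF in h1; rewrite -(cvg_lim _ h1) //; apply/cvg_lim => //.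
have -> : arcsine_prob \o F = fun n => ((v - u - 2 * d n) / pi)%:E.
  apply/funext => n /=; have [a1 a2] := (d0 n, d3 n).
  rewrite /F arcsine_prob_cc; [|lra|lra|lra].
  by congr EFin; ring.
apply: cvg_EFin; first by apply: nearW.
rewrite -[v - u in X in _ --> X]subr0 -[X in v - u - X](mulr0 2).
apply: cvgM; last exact: cvg_cst.
apply: cvgB; first exact: cvg_cst.
by apply: cvgM => //; exact: cvg_cst.
Qed.

Let arcsine_setT : arcsine_prob [set: _] = 1%E.
Proof.
have -> : arcsine_prob [set: _] = arcsine_prob `]2 * cos pi, 2 * cos 0[.
  rewrite /arcsine_prob [RHS]integral_mkcond cospi cos0 mulr1 mulrN1.
  apply: eq_integral => x _; rewrite patchE; case: ifPn => // x2.
  by rewrite arcsine_density_out //; apply: contra x2 => h; rewrite inE.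
by rewrite arcsine_prob_oo ?pi_gt0 // subr0 divff // gt_eqF ?pi_gt0.
Qed.

HB.instance Definition _ :=
  @Measure_isProbability.Build _ _ R arcsine_prob arcsine_setT.

End Arcsine.

(** * Weak convergence from lower bounds on the measure of cells *)

Section WeakLimit.
Variable R : realType.
Notation T := (measurableTypeR R).
Notation nu := (@arcsine_prob R).
Implicit Types (m : {measure set T -> \bar R}) (f g : R -> R) (u v x : R).

(** The cosine is decreasing, hence the order of the end points. *)
Definition angle_cell u v : set T := `]2 * cos v, 2 * cos u[%classic.

Let measurable_EFin_cont g (D : set T) : continuous g ->
  measurable_fun D (fun x => (g x)%:E).
Proof.
move=> cg; apply/measurable_EFinP; apply: measurable_funTS.
exact: continuous_measurable_fun.
Qed.

Lemma integral_cell_le m1 m2 (C : set T) g (k w r e : R) :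
  measurable C -> continuous g -> 0 <= k -> 0 <= e ->
  (forall x, C x -> k <= g x <= k + e) ->
  m1 C = w%:E -> ((w - r)%:E <= m2 C)%E ->
  (\int[m1]_(x in C) (g x)%:E <= \int[m2]_(x in C) (g x)%:E + (k * r + e * w)%:E)%E.
Proof.
move=> mC cg k0 e0 gC m1C m2C.
have ub : (\int[m1]_(x in C) (g x)%:E <= ((k + e) * w)%:E)%E.
  rewrite EFinM -m1C -integral_cst //; apply: ge0_le_integral.
  - exact: mC.
  - by move=> x /gC /andP[gx _]; rewrite lee_fin (le_trans k0).
  - exact: measurable_EFin_cont.
  - exact: measurable_cst.
  - by move=> x /gC /andP[_ gx]; rewrite lee_fin.
have lb : ((k * (w - r))%:E <= \int[m2]_(x in C) (g x)%:E)%E.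
  apply: le_trans (_ : k%:E * m2 C <= _)%E.
    by rewrite EFinM; apply: lee_wpmul2l => //; rewrite lee_fin.
  rewrite -integral_cst //; apply: ge0_le_integral.
  - exact: mC.
  - by move=> x _; rewrite lee_fin.
  - exact: measurable_cst.
  - exact: measurable_EFin_cont.
  - by move=> x /gC /andP[gx _]; rewrite lee_fin.
apply: le_trans ub (le_trans _ (leeD2r _ lb)).
by rewrite -EFinD lee_fin le_eqVlt; apply/orP; left; apply/eqP; ring.
Qed.

(* Grids with [p * K] cells have all the exceptional angles [k pi / p] among
   their nodes, so the lower bounds are available on each open cell. *)
Section Cells.
Variables (p : nat) (mu : nat -> {measure set T -> \bar R}).
Hypothesis p_gt0 : (0 < p)%N.
Hypothesis mu_le1 : forall n, (mu n setT <= 1)%E.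
Hypothesis mu_cell : forall u v, 0 <= u -> u < v -> v <= pi ->
  (forall x, u < x < v -> sin (p%:R * x) != 0) -> forall e : R, 0 < e ->
  \forall n \near \oo, (((v - u) / pi - e)%:E <= mu n (angle_cell u v))%E.

Let sin_cell (K i : nat) x : (0 < K)%N ->
  i%:R * pi / (p * K)%:R < x < i.+1%:R * pi / (p * K)%:R -> sin (p%:R * x) != 0.
Proof.
move=> K0 /andP[x1 x2]; have K0' : 0 < K%:R :> R by rewrite ltr0n.
have p0' : 0 < p%:R :> R by rewrite ltr0n.
have pi0 := pi_gt0 R.
pose q := (i %/ K)%N.
have qi : (q * K <= i)%N by exact: leq_trunc_div.
have iq : (i.+1 <= q.+1 * K)%N by rewrite -ltn_divLR.
have pK0 : 0 < (p * K)%:R :> R by rewrite ltr0n muln_gt0 p_gt0.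
have eX : x * (p * K)%:R = p%:R * x * K%:R by rewrite natrM; ring.
rewrite ltr_pdivrMr // eX in x1; rewrite ltr_pdivlMr // eX in x2.
have y0 : 0 < p%:R * x - pi *+ q < pi.
  rewrite -(ler_nat R) natrM in qi; rewrite -(ler_nat R) natrM in iq.
  have q1 := ler_wpM2r (ltW pi0) qi; have q2 := ler_wpM2r (ltW pi0) iq.
  rewrite -(mulr_natl pi q) subr_gt0 ltrBlDr; apply/andP; split; rewrite -(ltr_pM2r K0').
    by apply: le_lt_trans x1; rewrite mulrAC.
  apply: lt_le_trans x2 (le_trans q2 _).
  by rewrite -[q.+1%:R]natr1 le_eqVlt; apply/orP; left; apply/eqP; ring.
have -> : p%:R * x = (p%:R * x - pi *+ q) + pi *+ q by rewrite subrK.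
rewrite (alternatingn (@sinDpi R)) mulf_neq0 ?signr_eq0 //.
by rewrite gt_eqF // sin_gt0_pi.
Qed.

(** Riemann sums: on each cell of a fine grid [g] is nearly constant, and the
lower bounds for [mu n] on the cells add up. *)
Let lower_bound g (B d : R) : continuous g -> (forall x, 0 <= g x <= B) -> 0 < d ->
  \forall n \near \oo,
    (\int[nu]_x (g x)%:E <= \int[mu n]_x (g x)%:E + d%:E)%E.
Proof.
move=> cg gB d0; have pi0 := pi_gt0 R.
have B0 : 0 <= B by have /andP[h1 h2] := gB 0; exact: le_trans h2.
have d4 : 0 < d / 4 by rewrite divr_gt0.
have [|h h0 hh] := @segment_unif_continuous R _ (fun x => g (2 * cos x)) 0 pi _ _ d4.
  move=> x _; apply: (@continuous_comp _ _ _ (fun x : R => 2 * cos x) g).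
    by apply: cvgM; [exact: cvg_cst | exact: continuous_cos].
  exact: cg.
have [K K0 hK] : exists2 K, (0 < K)%N & pi / K%:R < h.
  have [N _ HN] := nbhs_infty_gtr (pi / h); exists N.+1 => //.
  rewrite ltr_pdivrMr ?ltr0n // mulrC -ltr_pdivrMr //.
  by apply: HN => /=.
pose N := (p * K)%N; have N0 : (0 < N)%N by rewrite muln_gt0 p_gt0.
have N0' : 0 < N%:R :> R by rewrite ltr0n.
pose th i : R := i%:R * pi / N%:R.
have th0 : th 0 = 0 by rewrite /th !mul0r.
have thN : th N = pi by rewrite /th mulrAC divff ?mul1r // gt_eqF.
have thS i : th i.+1 - th i = pi / N%:R by rewrite /th -natr1; ring.
have th_lt i : th i < th i.+1 by rewrite -subr_gt0 thS divr_gt0.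
have th_ge0 i : 0 <= th i by rewrite /th !mulr_ge0 ?invr_ge0 ?ler0n // ltW.
have th_le i : (i <= N)%N -> th i <= pi.
  move=> iN; rewrite /th ler_pdivrMr // mulrC ler_pM2l // ler_nat //.
have step : pi / N%:R < h.
  apply: le_lt_trans hK; rewrite ler_pM2l // lef_pV2 ?posrE ?ltr0n //.
  by rewrite ler_nat leq_pmull.
(* tolerance on the mass of a cell: summed over [N] cells and multiplied by
   [g <= B] it contributes at most [d / 2] *)
pose r : R := d / 2 / (B + 1) / N%:R.
have B10 : 0 < B + 1 by rewrite ltr_wpDl.
have r0 : 0 < r by rewrite !divr_gt0.
have near_cells : \forall n \near \oo, forall i : 'I_N,
    ((N%:R^-1 - r)%:E <= mu n (angle_cell (th i) (th i.+1)))%E.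
  apply: filter_forall => i.
  have := mu_cell (th_ge0 i) (th_lt i) (th_le _ (ltn_ord i)).
  move=> /(_ _ _ r0); rewrite thS mulrAC divff ?gt_eqF // mul1r; apply.
  by move=> x; exact: sin_cell.
move: near_cells; apply: filterS => n hn.
pose C i : set T := `[2 * cos (th i.+1), 2 * cos (th i)[%classic.
pose D i : set T := `[2 * cos (th i), 2[%classic.
have mC i : measurable (C i) by exact: measurable_itv.
have mD i : measurable (D i) by exact: measurable_itv.
have cell i : (i < N)%N ->
    (\int[nu]_(x in C i) (g x)%:E <=
     \int[mu n]_(x in C i) (g x)%:E + (d / N%:R)%:E)%E.
  move=> iN; set c := g (2 * cos (th i)).
  have gc x : C i x -> c - d / 4 <= g x <= c + d / 4.
    rewrite /C /= in_itv /= => /andP[x1 x2].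
    have [|y /andP[y0 ypi] xy] := @two_cos_surj _ x.
      have := cos_geN1 (th i.+1); have := cos_le1 (th i) => b1 b2.
      by apply/andP; split; lra.
    have ty : th i < y.
      rewrite ltNge; apply/negP => yt.
      by have := ler_cos y0 yt (th_le _ (ltnW iN)); lra.
    have yt : y <= th i.+1.
      rewrite leNgt; apply/negP => yt.
      have : cos y < cos (th i.+1).
        by rewrite ltr_cos // in_itv /= ?y0 // th_ge0 th_le.
      lra.
    have := hh (th i) y; rewrite !in_itv /= th_ge0 (th_le _ (ltnW iN)) y0 ypi.
    move=> /(_ isT isT); rewrite -xy -/c distrC gtr0_norm ?subr_gt0 //.
    have -> : y - th i < h.
      by apply: le_lt_trans step; rewrite -(thS i) lerD2r.
    by move=> /(_ isT); rewrite distrC ltr_norml => /andP[]; lra.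
  pose k := Num.max 0 (c - d / 4).
  have k0 : 0 <= k by rewrite le_max lexx.
  have kB : k <= B.
    rewrite ge_max B0 /=; have /andP[_] := gB (2 * cos (th i)); rewrite -/c; lra.
  have nuC : nu (C i) = (N%:R^-1)%:E.
    have <- : nu (angle_cell (th i) (th i.+1)) = (N%:R^-1)%:E.
      rewrite /angle_cell arcsine_prob_oo ?th_le // thS mulrAC divff ?mul1r //.
      by rewrite gt_eqF.
    symmetry; apply: integral_itv_obnd_cbnd.
    apply/measurable_EFinP; exact: measurable_arcsine_density.
  have muC : ((N%:R^-1 - r)%:E <= mu n (C i))%E.
    apply: le_trans (hn (Ordinal iN)) _; apply: le_measure; rewrite ?inE //.
      exact: measurable_itv.
    by move=> x; rewrite /angle_cell /C /= !in_itv /= => /andP[/ltW -> ->].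
  have d2 : 0 <= d / 2 by rewrite divr_ge0 // ltW.
  apply: le_trans (integral_cell_le (mC i) cg k0 d2 _ nuC muC) _.
    move=> x Cx; have /andP[g1 g2] := gc _ Cx; have /andP[g3 g4] := gB x.
    rewrite /k ge_max g3 g1 /=; case: (leP 0 (c - d / 4)) => h1; lra.
  rewrite leeD2l // lee_fin.
  have -> : d / N%:R = d / 2 / N%:R + d / 2 / N%:R by field; rewrite gt_eqF.
  rewrite lerD // /r mulrA ler_pM2r ?invr_gt0 // mulrA ler_pdivrMr // mulrC.
  by rewrite ler_pM2l ?divr_gt0 // (le_trans kB) // lerDl.
have cover i : (i <= N)%N ->
    (\int[nu]_(x in D i) (g x)%:E <=
     \int[mu n]_(x in D i) (g x)%:E + (i%:R * (d / N%:R))%:E)%E.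
  elim: i => [|i IH] iN.
    rewrite /D th0 cos0 mulr1.
    have -> : `[2, 2[%classic = set0 :> set T.
      by apply/seteqP; split => x //=; rewrite in_itv /= => /andP[a1]; rewrite ltNge a1.
    by rewrite !integral_set0 mul0r add0e.
  have DS : D i.+1 = C i `|` D i.
    apply/seteqP; split => x; rewrite /D /C /= !in_itv /=.
      by move=> /andP[-> ->]; case: (ltP x (2 * cos (th i))); [left|right].
    have ct : 2 * cos (th i.+1) <= 2 * cos (th i).
      by rewrite ler_pM2l // ler_cos // ?th_le // ltW.
    have c2 : 2 * cos (th i) <= 2.
      by rewrite -[leRHS]mulr1 ler_pM2l // cos_le1.
    move=> [/andP[-> x2]|/andP[x1 ->]]; first by rewrite (lt_le_trans x2).
    by rewrite (le_trans ct).
  have dis : [disjoint C i & D i].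
    rewrite disj_set2E; apply/eqP/seteqP; split => x //=.
    rewrite /D /C /= !in_itv /= => -[/andP[_ x2] /andP[x1 _]].
    by move: x2; rewrite ltNge x1.
  have mg (E : set T) : measurable_fun E (fun x => (g x)%:E).
    exact: measurable_EFin_cont.
  have g0 (E : set T) x : E x -> (0 <= (g x)%:E)%E.
    by move=> _; rewrite lee_fin; have /andP[] := gB x.
  rewrite DS !ge0_integral_setU //; [|exact: g0..].
  apply: le_trans (leeD (cell _ iN) (IH (ltnW iN))) _.
  by rewrite addeACA -EFinD -natr1 mulrDl mul1r [(d / _ + _)%R]addrC.
have mg (E : set T) : measurable_fun E (fun x => (g x)%:E).
  exact: measurable_EFin_cont.
have g0 (E : set T) x : E x -> (0 <= (g x)%:E)%E.
  by move=> _; rewrite lee_fin; have /andP[] := gB x.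
have nuD : nu (~` D N) = 0%E.
  have nuD1 : nu (D N) = 1%E.
    apply/eqP; rewrite eq_le probability_le1 //=.
    have <- : nu (angle_cell 0 pi) = 1%E.
      by rewrite /angle_cell arcsine_prob_oo // subr0 divff // gt_eqF.
    apply: le_measure; rewrite ?inE //; first exact: measurable_itv.
    move=> x; rewrite /angle_cell /D thN cos0 mulr1 /= !in_itv /=.
    by move=> /andP[/ltW -> ->].
  transitivity (1 - 1 : \bar R)%E; last by rewrite subee.
  apply: etrans (probability_setC _ (mD N)) _; congr (_ - _)%E; exact: nuD1.
have nuDg : (\int[nu]_(x in ~` D N) (g x)%:E <= 0)%E.
  apply: le_trans (_ : B%:E * nu (~` D N) <= _)%E; last by rewrite nuD mule0.
  rewrite -integral_cst; last exact: measurableC.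
  apply: ge0_le_integral.
  - exact: measurableC.
  - exact: g0.
  - exact: mg.
  - exact: measurable_cst.
  - by move=> x _; rewrite lee_fin; have /andP[] := gB x.
have dis : [disjoint D N & ~` D N] by rewrite disj_set2E setICr.
have split_nu := ge0_integral_setU nu (mD N) (measurableC (mD N)) (mg _) (g0 _) dis.
rewrite setUv in split_nu; rewrite split_nu.
apply: le_trans (leeD (cover N (leqnn N)) nuDg) _.
rewrite adde0 mulrCA divff ?gt_eqF // mulr1 leeD2r //.
exact: (ge0_subset_integral (mu n) (mD N) measurableT (mg _) (g0 _) (@subsetT _ _)).
Qed.

Let integrable_bounded m f (M : R) : (m setT <= 1)%E -> continuous f ->
  (forall x, `|f x| <= M) -> m.-integrable setT (EFin \o f).
Proof.
move=> m1 cf fM; apply/integrableP; split; first exact: measurable_EFin_cont.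
have M0 : 0 <= M by exact: le_trans (fM 0).
have h : (\int[m]_x `|(f x)%:E| <= M%:E * m setT)%E.
  apply: integral_le_bound => //; first exact: measurable_EFin_cont.
  by apply: aeW => x _; rewrite /= lee_fin.
apply: le_lt_trans h _; apply: le_lt_trans (_ : M%:E * 1 < _)%E.
  by apply: lee_wpmul2l => //; rewrite lee_fin.
by rewrite mule1 ltry.
Qed.

Let nu_setT : nu setT = 1%E.
Proof. exact: probability_setT. Qed.

(* apply [lower_bound] to [f + M >= 0]; the shift costs nothing because
   [mu n] has mass at most 1 and [nu] has mass 1 *)
Let half_limit f (M d : R) : continuous f -> (forall x, `|f x| <= M) -> 0 < d ->
  \forall n \near \oo,
    (\int[nu]_x (f x)%:E <= \int[mu n]_x (f x)%:E + d%:E)%E.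
Proof.
move=> cf fM d0; have M0 : 0 <= M by exact: le_trans (fM 0).
pose g x := f x + M.
have cg : continuous g by move=> x; apply: cvgD; [exact: cf | exact: cvg_cst].
have gB x : 0 <= g x <= M + M.
  by have := fM x; rewrite ler_norml /g => /andP[h1 h2]; apply/andP; split; lra.
have shift m : (m setT <= 1)%E ->
    (\int[m]_x (g x)%:E = \int[m]_x (f x)%:E + M%:E * m setT)%E.
  move=> m1; rewrite -integral_cst //.
  have cM : continuous (fun _ : R => M) by move=> x; exact: cvg_cst.
  have MM x : `|(fun _ : R => M) x| <= M by rewrite ger0_norm.
  by rewrite -(integralD_EFin measurableT (integrable_bounded m1 cf fM)
    (integrable_bounded m1 cM MM)).
have := lower_bound cg gB d0; apply: filterS => n.
have nu1 : (nu setT <= 1)%E by rewrite nu_setT.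
have shift_nu : (\int[nu]_x (g x)%:E = \int[nu]_x (f x)%:E + M%:E)%E.
  apply: etrans (shift nu nu1) _; congr (_ + _)%E.
  exact: etrans (congr1 (mule M%:E) nu_setT) (mule1 _).
move=> h; rewrite shift_nu (shift (mu n) (mu_le1 n)) in h.
have finf m : (m setT <= 1)%E -> (\int[m]_x (f x)%:E)%E \is a fin_num.
  by move=> m1; apply: integrable_fin_num => //; exact: integrable_bounded fM.
rewrite -(leeD2rE _ _ (_ : M%:E \is a fin_num)) //; apply: le_trans h _.
rewrite addeAC leeD2l // -[leRHS]mule1.
by apply: lee_wpmul2l => //; rewrite lee_fin.
Qed.

(** Every cell eventually carries at least its arcsine mass; as the total masses
do not exceed 1, no cell can carry more in the limit. *)
Lemma weak_limit_arcsine : weak_limit mu nu.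
Proof.
move=> f cf [M fM].
have finf m : (m setT <= 1)%E -> (\int[m]_x (f x)%:E)%E \is a fin_num.
  by move=> m1; apply: integrable_fin_num => //; exact: integrable_bounded fM.
have nu1 : (nu setT <= 1)%E by rewrite nu_setT.
rewrite -(fineK (finf _ nu1)).
have -> : (fun n => \int[mu n]_x (f x)%:E)%E =
          (fun n => (fine (\int[mu n]_x (f x)%:E))%:E).
  by apply/funext => n; rewrite fineK // finf.
apply: cvg_EFin; first exact: nearW.
apply/cvgrPdist_le => d d0.
have cNf : continuous (fun x => - f x) by move=> x; apply: cvgN; exact: cf.
have fNM x : `|- f x| <= M by rewrite normrN.
have h1 := half_limit cf fM d0; have h2 := half_limit cNf fNM d0.
apply: filterS2 h1 h2 => n.
have oppI m : (m setT <= 1)%E ->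
    (\int[m]_x (- f x)%:E)%E = (- fine (\int[m]_x (f x)%:E))%:E.
  move=> m1; rewrite EFinN fineK ?finf //.
  by rewrite -(integralN (integrable_add_def measurableT (integrable_bounded m1 cf fM))).
rewrite !oppI // -(fineK (finf _ nu1)) -(fineK (finf _ (mu_le1 n))) -!EFinD !lee_fin.
by rewrite ler_norml /= => e1 e2; apply/andP; split; lra.
Qed.

End Cells.
End WeakLimit.

(** * Counting zeros, and the spacing of successive zeros *)

Section Counting.
Variable R : realType.
Implicit Types (a b : nat -> R) (n : nat) (x y : R).

Lemma mem_rootsR (q : {poly R}) x : q != 0 -> (x \in rootsR q) = root q x.
Proof. by move=> q0; rewrite -(roots_on_rootsR q0) in_itv. Qed.

Lemma uniq_rootsR (q : {poly R}) : uniq (rootsR q).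
Proof. exact: uniq_roots. Qed.

Lemma zero_measureE a b n (A : set (measurableTypeR R)) :
  zero_measure a b n A =
  (n%:R^-1 * (count (fun z => z \in A) (rootsR (orthopoly a b n)))%:R)%:E.
Proof.
rewrite /zero_measure /= /mscale /= /msum /= EFinM; congr (_ * _)%E.
set zs := rootsR _.
have -> : (count (fun z => z \in A) zs)%:R = \sum_(z <- zs) (z \in A)%:R :> R.
  by rewrite -sum1_count natr_sum big_mkcond; apply: eq_bigr => z _; case: (_ \in A).
rewrite (big_nth 0) big_mkord -sumEFin; apply: eq_bigr => i _; exact: diracE.
Qed.

Lemma zero_measure_le1 a b n : (forall k, (0 < k)%N -> 0 < a k) ->
  (zero_measure a b n setT <= 1)%E.
Proof.
move=> a0; rewrite zero_measureE lee_fin; case: n => [|n].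
  by rewrite invr0 mul0r ler01.
rewrite mulrC ler_pdivrMr ?ltr0n // mul1r ler_nat.
apply: leq_trans (count_size _ _) _; rewrite -ltnS -(size_orthopoly b a0 n.+1).
apply: max_poly_roots; [exact: orthopoly_neq0| |exact: uniq_rootsR].
by apply/allP => x; rewrite mem_rootsR // orthopoly_neq0.
Qed.

Lemma zero_measure_ge a b n (A : set (measurableTypeR R)) (zs : seq R) :
  (forall k, (0 < k)%N -> 0 < a k) -> uniq zs ->
  (forall z, z \in zs -> root (orthopoly a b n) z /\ A z) ->
  ((n%:R^-1 * (size zs)%:R)%:E <= zero_measure a b n A)%E.
Proof.
move=> a0 uzs hzs; rewrite zero_measureE lee_fin ler_wpM2l ?invr_ge0 // ler_nat.
rewrite -size_filter; apply: uniq_leq_size => // z /hzs[rz Az].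
by rewrite mem_filter mem_set //= mem_rootsR ?orthopoly_neq0.
Qed.

Section Good.
Variables (a b : nat -> R) (p : nat).
Hypothesis a_gt0 : forall n, (0 < n)%N -> 0 < a n.
Hypothesis a_tame : tame p (fun n => a n.+1) 1.
Hypothesis b_tame : tame p (fun n => b n.+1) 0.
Hypothesis p_gt0 : (0 < p)%N.

Let within s t (e : R) : 0 < s -> s <= t -> t < pi ->
  {in `[s, t], forall x, sin (p%:R * x) != 0} -> 0 < e ->
  \forall n \near \oo, forall x,
  x \in `[s, t] -> x + (pi + e) / n%:R \in `[s, t] ->
  exists2 E : R, 2 * cos (x + (pi + e) / n%:R) < E < 2 * cos x &
    root (orthopoly a b n) E.
Proof.
move=> s0 st tpi sn e0; have [c [sg [/andP[c0 c1] sg1 hc]]] := sin_sign st sn.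
exact: (zero_within a_gt0 a_tame b_tame p_gt0 s0 st tpi c0 c1 sg1 hc e0).
Qed.

Let apart s t (e : R) : 0 < s -> s <= t -> t < pi ->
  {in `[s, t], forall x, sin (p%:R * x) != 0} -> 0 < e ->
  \forall n \near \oo, {in `[s, t] &, forall x y, x < y ->
    root (orthopoly a b n) (2 * cos x) -> root (orthopoly a b n) (2 * cos y) ->
    pi - e <= n%:R * (y - x)}.
Proof.
move=> s0 st tpi sn e0; have [c [sg [/andP[c0 c1] sg1 hc]]] := sin_sign st sn.
exact: (zeros_apart a_gt0 a_tame b_tame p_gt0 s0 st tpi c0 c1 sg1 hc e0).
Qed.

(** Cut a closed segment inside the cell into windows of angular length slightly
more than [pi / n]; each contains a zero, and zeros of different windows differ. *)
Lemma zero_measure_cell u v : 0 <= u -> u < v -> v <= pi ->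
  (forall x, u < x < v -> sin (p%:R * x) != 0) -> forall e : R, 0 < e ->
  \forall n \near \oo,
    (((v - u) / pi - e)%:E <= zero_measure a b n (angle_cell u v))%E.
Proof.
move=> u0 uv vpi good e e0; have pi0 := pi_gt0 R; have pi2 := pi_ge2 R.
have [d [d0 de duv]] : exists d : R, [/\ 0 < d, d <= e / 3 & d <= (v - u) / 4].
  exists (Num.min (e / 3) ((v - u) / 4)); rewrite lt_min !ge_min !lexx orbT.
  by rewrite !divr_gt0 // subr_gt0.
have s0 : 0 < u + d by lra.
have st : u + d <= v - d by lra.
have tpi : v - d < pi by lra.
have sn : {in `[u + d, v - d], forall x, sin (p%:R * x) != 0}.
  by move=> x; rewrite in_itv /= => /andP[x1 x2]; apply: good; apply/andP; split; lra.
have e3 : 0 < e / 3 by rewrite divr_gt0.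
have hw := within s0 st tpi sn e3.
have hn := nbhs_infty_ger (3 / e + 1).
near=> n.
have n3 : 3 / e + 1 <= n%:R by near: n.
have n0 : 0 < n%:R :> R by rewrite (lt_le_trans _ n3) // ltr_wpDl // divr_ge0 // ltW.
have Hw : forall x, x \in `[u + d, v - d] ->
    x + (pi + e / 3) / n%:R \in `[u + d, v - d] ->
    exists2 E : R, 2 * cos (x + (pi + e / 3) / n%:R) < E < 2 * cos x &
    root (orthopoly a b n) E by near: n.
set h := (pi + e / 3) / n%:R in Hw.
have pe0 : 0 < pi + e / 3 by rewrite addr_gt0.
have h0 : 0 < h by rewrite divr_gt0.
set s := u + d in s0 st sn Hw *; set t := v - d in st tpi sn Hw *.
pose J := Num.truncn ((t - s) / h).
have ts0 : 0 <= (t - s) / h by rewrite divr_ge0 ?subr_ge0 // ltW.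
have /andP[J1 J2] := truncn_itv ts0; rewrite -/J in J1 J2.
pose x i : R := s + i%:R * h.
have xS i : x i.+1 = x i + h by rewrite /x -natr1; ring.
have xle i j : (i <= j)%N -> x i <= x j.
  by move=> ij; rewrite lerD2l ler_pM2r // ler_nat.
have xst i : (i <= J)%N -> x i \in `[s, t].
  move=> iJ; rewrite in_itv /= lerDl mulr_ge0 ?ler0n ?(ltW h0) //=.
  rewrite /x addrC -lerBrDr -ler_pdivlMr // (le_trans _ J1) // ler_nat //.
have /choice[E HE] : forall i : 'I_J, exists E : R,
    [/\ 2 * cos (x i.+1) < E, E < 2 * cos (x i) & root (orthopoly a b n) E].
  move=> i; have [||E /andP[E1 E2] rE] := Hw (x i).
  - by rewrite xst // ltnW.
  - by rewrite -xS xst.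
  - by exists E; rewrite xS.
have in0pi i : (i <= J)%N -> 0 <= x i /\ x i <= pi.
  move=> /xst; rewrite in_itv /= => /andP[x1 x2]; split; first by rewrite (le_trans (ltW s0)).
  by rewrite (le_trans x2) // ltW.
have Einj : injective E.
  suff lt_E (i j : 'I_J) : (i < j)%N -> E j < E i.
    move=> i j Eij; apply/val_inj; case: (ltngtP i j) => // /lt_E.
      by rewrite Eij ltxx.
    by rewrite Eij ltxx.
  move=> ij; have [_ Ej _] := HE j; have [Ei _ _] := HE i.
  apply: lt_trans Ej (le_lt_trans _ Ei); rewrite ler_pM2l // ler_cos //.
  - by have [] := in0pi i.+1 (ltn_ord i).
  - exact: xle.
  - by have [] := in0pi j (ltnW (ltn_ord j)).
pose zs := map E (enum 'I_J).
have szs : size zs = J by rewrite size_map size_enum_ord.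
apply: le_trans (zero_measure_ge (zs := zs) a_gt0 _ _); last 2 first.
- by rewrite map_inj_uniq ?enum_uniq.
- move=> _ /mapP[i _ ->]; have [E1 E2 rE] := HE i; split=> //.
  have [xi0 xipi] := in0pi i (ltnW (ltn_ord i)).
  have [xS0 xSpi] := in0pi i.+1 (ltn_ord i).
  have := xst i (ltnW (ltn_ord i)); have := xst i.+1 (ltn_ord i).
  rewrite !in_itv /= => /andP[_ xv] /andP[xu _].
  rewrite /angle_cell /= in_itv /=; apply/andP; split.
    by apply: le_lt_trans E1; rewrite ler_pM2l // ler_cos //; rewrite /t in xv; lra.
  by apply: lt_le_trans E2 _; rewrite ler_pM2l // ler_cos //; rewrite /s in xu; lra.
rewrite szs lee_fin.
(* [J > (t - s) / h - 1] with [h = (pi + e / 3) / n], [t - s = v - u - 2 d] *)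
have J3 : (t - s) / (pi + e / 3) <= n%:R^-1 * J%:R + n%:R^-1.
  have -> : n%:R^-1 * J%:R + n%:R^-1 = n%:R^-1 * J.+1%:R :> R.
    by rewrite -[J.+1%:R]natr1 mulrDr mulr1.
  rewrite ler_pdivlMl //; apply: le_trans (ltW J2).
  by rewrite /h invf_div mulrCA.
have n4 : n%:R^-1 <= e / 3.
  rewrite -[e / 3]invrK invf_div lef_pV2 ?posrE ?divr_gt0 //.
  by rewrite (le_trans _ n3) // lerDl.
have J4 : (v - u) / pi - e / 3 - e / 3 <= (t - s) / (pi + e / 3).
  rewrite ler_pdivlMr //.
  have -> : t - s = v - u - 2 * d by rewrite /t /s; ring.
  have q1 : (v - u) / pi <= 1 by rewrite ler_pdivrMr // mul1r; lra.
  have q0 : 0 <= (v - u) / pi by rewrite divr_ge0 ?subr_ge0 // ltW.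
  have -> : v - u = (v - u) / pi * pi by rewrite mulfVK // gt_eqF.
  set q := (v - u) / pi in q0 q1 *; rewrite mulfK ?gt_eqF //.
  have m1 : q * (e / 3) <= e / 3 by rewrite ler_piMl // ltW.
  have m2 : 2 * (e / 3) <= pi * (e / 3) by rewrite ler_pM2r.
  have m3 : 0 <= (e / 3) * (e / 3) by rewrite mulr_ge0 // ltW.
  have -> : (q - e / 3 - e / 3) * (pi + e / 3) =
    q * pi + q * (e / 3) - 2 * (pi * (e / 3)) - 2 * (e / 3 * (e / 3)) by ring.
  lra.
rewrite /J in J3 *; lra.
Unshelve. all: by end_near.
Qed.

Lemma zero_measure_weak_limit : density_of_states a b (@arcsine_prob R).
Proof.
apply: (@weak_limit_arcsine _ p) => // [n|]; first exact: zero_measure_le1.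
exact: zero_measure_cell.
Qed.

Section Clock.
Variables s t : R.
Hypotheses (s_gt0 : 0 < s) (s_le_t : s <= t) (t_lt_pi : t < pi).
Hypothesis sin_neq0 : {in `[s, t], forall x, sin (p%:R * x) != 0}.

Lemma successive_angles (e : R) : 0 < e -> \forall n \near \oo,
  {in `[s, t] &, forall x y, x < y ->
    successive_zeros (orthopoly a b n) (2 * cos x) (2 * cos y) ->
    `|n%:R * (y - x) - pi| <= e}.
Proof.
move=> e0; have hw := within s_gt0 s_le_t t_lt_pi sin_neq0 e0.
have ha := apart s_gt0 s_le_t t_lt_pi sin_neq0 e0.
have hn : \forall n \near \oo, (0 < n)%N by exists 1.
near=> n => x y xst yst xy [rx ry _ nz].
have n0 : 0 < n%:R :> R by rewrite ltr0n; near: n.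
have Ha : {in `[s, t] &, forall x y, x < y ->
    root (orthopoly a b n) (2 * cos x) -> root (orthopoly a b n) (2 * cos y) ->
    pi - e <= n%:R * (y - x)} by near: n.
have Hw : forall x, x \in `[s, t] -> x + (pi + e) / n%:R \in `[s, t] ->
  exists2 E : R, 2 * cos (x + (pi + e) / n%:R) < E < 2 * cos x &
    root (orthopoly a b n) E by near: n.
have lo := Ha _ _ xst yst xy rx ry.
suff hi : n%:R * (y - x) <= pi + e by rewrite ler_norml; apply/andP; split; lra.
rewrite leNgt; apply/negP => hlt.
have h0 : 0 < (pi + e) / n%:R by rewrite divr_gt0 // addr_gt0 // pi_gt0.
have hy : x + (pi + e) / n%:R < y by rewrite -ltrBrDl ltr_pdivrMr // mulrC.
move: (xst) (yst); rewrite !in_itv /= => /andP[sx xt] /andP[sy yt].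
have [|E /andP[E1 E2] rE] := Hw _ xst.
  by rewrite in_itv /= (le_trans sx) ?lerDl ?(ltW h0) //= (le_trans (ltW hy)).
have cxy : 2 * cos y <= 2 * cos x.
  rewrite ler_pM2l // ler_cos ?(ltW xy) //; first by rewrite (le_trans (ltW s_gt0)).
  by rewrite (le_trans yt) // ltW.
move: (nz _ rE); rewrite min_r // max_l // E2 andbT => /negP; apply.
apply: le_lt_trans E1; rewrite ler_pM2l // ler_cos ?(ltW hy) //.
  by rewrite addr_ge0 ?(ltW h0) // (le_trans (ltW s_gt0)).
by rewrite (le_trans yt) // ltW.
Unshelve. all: by end_near.
Qed.

Let succ_sym n x y : successive_zeros (orthopoly a b n) x y ->
  successive_zeros (orthopoly a b n) y x.
Proof.
by move=> [rx ry xy nz]; split=> // [|z rz]; [rewrite eq_sym | rewrite minC maxC nz].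
Qed.

Lemma arcsine_density_inv x : 0 <= x <= pi ->
  (arcsine_density (2 * cos x))^-1 = 2 * pi * sin x.
Proof.
move=> xpi; rewrite /arcsine_density invrK.
have -> : 4 - (2 * cos x) ^+ 2 = (2 * sin x) ^+ 2 by rewrite !exprMn sin2cos2; ring.
by rewrite sqrtr_sqr ger0_norm ?mulr_ge0 ?sin_ge0_pi //; ring.
Qed.

(** From angles to energies: [x |-> 2 cos x] stretches the spacing [pi / n] by
[2 sin], evaluated close to [x], and [2 pi sin x] is the inverse of the density. *)
Lemma clock_spacing (e : R) : 0 < e -> \forall n \near \oo,
  {in `[s, t] &, forall x y,
    successive_zeros (orthopoly a b n) (2 * cos x) (2 * cos y) ->
    `|n%:R * `|2 * cos x - 2 * cos y| - (arcsine_density (2 * cos x))^-1| <= e}.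
Proof.
move=> e0; have pi0 := pi_gt0 R; have pi2 := pi_ge2 R.
have e4 : 0 < Num.min (e / 4) 1 by rewrite lt_min divr_gt0 // ltr01.
have hs := successive_angles e4.
have hn := nbhs_infty_ger (4 * pi * (pi + 1) / e + 1).
near=> n => x y xst yst suc.
have n3 : 4 * pi * (pi + 1) / e + 1 <= n%:R by near: n.
have c0 : 0 <= 4 * pi * (pi + 1) / e.
  apply: divr_ge0 (ltW e0); apply: mulr_ge0; last by rewrite addr_ge0 // pi_ge0.
  by rewrite mulr_ge0 // pi_ge0.
have n0 : 0 < n%:R :> R by rewrite (lt_le_trans _ n3) // ltr_wpDl.
have Hs : {in `[s, t] &, forall x y, x < y ->
    successive_zeros (orthopoly a b n) (2 * cos x) (2 * cos y) ->
    `|n%:R * (y - x) - pi| <= Num.min (e / 4) 1} by near: n.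
have itv z : z \in `[s, t] -> 0 <= z <= pi.
  rewrite in_itv /= => /andP[z1 z2].
  by rewrite (le_trans (ltW s_gt0)) // (le_trans z2) // ltW.
have xy : x != y by apply/eqP => exy; case: suc; rewrite exy eqxx.
have gap : `|n%:R * `|x - y| - pi| <= Num.min (e / 4) 1.
  have [lt_xy|lt_yx|e_xy] := ltgtP x y.
  - by rewrite [`|x - y|]distrC [`|y - x|]gtr0_norm ?subr_gt0 //; exact: Hs.
  - rewrite [`|x - y|]gtr0_norm ?subr_gt0 //; apply: Hs => //; exact: succ_sym.
  - by rewrite e_xy eqxx in xy.
have gap4 : `|n%:R * `|x - y| - pi| <= e / 4 by rewrite (le_trans gap) // ge_min lexx.
have gap1 : n%:R * `|x - y| <= pi + 1.
  have : `|n%:R * `|x - y| - pi| <= 1 by rewrite (le_trans gap) // ge_min lexx orbT.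
  by rewrite ler_norml => /andP[]; lra.
have -> : (arcsine_density (2 * cos x))^-1 = 2 * pi * sin x.
  by apply: arcsine_density_inv; exact: itv.
(* mean value theorem: [cos x - cos y = sin z (y - x)] for some [z] in between *)
have [z [zd zin ec]] : exists z, [/\ `|z - x| <= `|x - y|, 0 <= z <= pi &
    `|cos x - cos y| = sin z * `|x - y|].
  have mvt u v : u \in `[s, t] -> v \in `[s, t] -> u < v -> exists z,
      [/\ u <= z <= v, 0 <= z <= pi & cos v - cos u = - sin z * (v - u)].
    move=> ust vst uv.
    have dc (r : R) : r \in `]u, v[ -> is_derive r 1 cos (- sin r).
      by move=> _; exact: is_derive_cos.
    have cc : {within `[u, v], continuous (@cos R)}.
      exact/continuous_subspaceT/continuous_cos.
    have [z zuv ez] := MVT_segment (ltW uv) dc cc.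
    move: zuv; rewrite in_itv /= => /andP[uz zv]; exists z; rewrite uz zv; split=> //.
    have /andP[u0 _] := itv _ ust; have /andP[_ vpi] := itv _ vst.
    by rewrite (le_trans u0) // (le_trans zv).
  have [lt_xy|lt_yx|e_xy] := ltgtP x y; last by rewrite e_xy eqxx in xy.
    have [z [/andP[xz zy] z0pi ez]] := mvt _ _ xst yst lt_xy; exists z; split=> //.
      by rewrite ger0_norm ?subr_ge0 // distrC gtr0_norm ?subr_gt0 // lerD2r.
    by rewrite distrC ez normrM normrN (ger0_norm (sin_ge0_pi z0pi)) [X in _ = _ * X]distrC.
  have [z [/andP[yz zx] z0pi ez]] := mvt _ _ yst xst lt_yx; exists z; split=> //.
    rewrite distrC ger0_norm ?subr_ge0 // gtr0_norm ?subr_gt0 //.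
    by rewrite lerD2l lerN2.
  by rewrite ez normrM normrN (ger0_norm (sin_ge0_pi z0pi)).
rewrite -mulrBr normrM normr_nat ec.
have -> : n%:R * (2 * (sin z * `|x - y|)) - 2 * pi * sin x =
  2 * (sin z * (n%:R * `|x - y| - pi) + pi * (sin z - sin x)) by ring.
rewrite normrM normr_nat.
have t1 : `|sin z * (n%:R * `|x - y| - pi)| <= e / 4.
  by rewrite normrM (le_trans _ gap4) // ler_piMl // sin_max.
have t2 : `|pi * (sin z - sin x)| <= e / 4.
  rewrite normrM (gtr0_norm pi0) mulrC -ler_pdivlMr //.
  rewrite (le_trans (ler_dist_sin _ _)) // (le_trans zd) //.
  rewrite -(ler_pM2l n0) (le_trans gap1) // mulrC.
  have -> : pi + 1 = e / 4 / pi * (4 * pi * (pi + 1) / e).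
    by move: (pi : R) pi0 => P P0; field; rewrite !gt_eqF.
  by rewrite ler_pM2l ?divr_gt0 // (le_trans _ n3) // lerDl.
have := ler_normD (sin z * (n%:R * `|x - y| - pi)) (pi * (sin z - sin x)).
lra.
Unshelve. all: by end_near.
Qed.

End Clock.
End Good.
End Counting.

(** * The density of states and the clock *)

Lemma tame_summable (R : realType) (p : nat) (c d : nat -> R) (l m : R) :
  c n @[n --> \oo] --> l -> d n @[n --> \oo] --> m ->
  (\sum_(1 <= n <oo)
     (`|c (n + p)%N - c n| + `|d (n + p)%N - d n|)%:E < +oo)%E ->
  tame p (fun n => c n.+1) l /\ tame p (fun n => d n.+1) m.
Proof.
move=> cl dm hsum.
pose u n : R := `|c (n + p)%N - c n| + `|d (n + p)%N - d n|.
have u0 n : 0 <= u n by rewrite addr_ge0.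
have ue0 n : (1 <= n)%N -> true -> (0 <= (u n)%:E)%E by rewrite lee_fin.
have fin : (\sum_(1 <= n <oo) (u n)%:E)%E \is a fin_num.
  by rewrite ge0_fin_numE //; apply: nneseries_ge0 => n n1 _; exact: ue0.
have hC N : \sum_(n < N) u n.+1 <= fine (\sum_(1 <= n <oo) (u n)%:E)%E.
  rewrite -lee_fin fineK //; apply: le_trans (nneseries_lim_ge N.+1 ue0).
  by rewrite sumEFin lee_fin big_add1 big_mkord.
rewrite -(cvg_shiftn 1) in cl; rewrite -(cvg_shiftn 1) in dm.
split; (split; first by under eq_fun do rewrite -addn1).
  exists (fine (\sum_(1 <= n <oo) (u n)%:E)%E) => N.
  by apply: le_trans (hC N); apply: ler_sum => n _; rewrite /u addSn lerDl.
exists (fine (\sum_(1 <= n <oo) (u n)%:E)%E) => N.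
by apply: le_trans (hC N); apply: ler_sum => n _; rewrite /u addSn lerDr.
Qed.

Unset Implicit Arguments.

Theorem corollary3p7 (R : realType) (a b : nat -> R) (p : nat)
    (hab : jacobi_parameters a b)
    (ha : a n @[n --> \oo] --> (1 : R))
    (hb : b n @[n --> \oo] --> (0 : R))
    (hp : (1 <= p)%N)
    (hsum : (\sum_(1 <= n <oo)
       (`|a (n + p)%N - a n| + `|b (n + p)%N - b n|)%:E < +oo)%E)
    (alpha beta : R) (hle : alpha <= beta)
    (hsub : `[alpha, beta] `<=`
       [set E : R | exists theta : R,
          [/\ 0 < theta < pi,
              forall k : nat, (1 <= k < p)%N -> theta != k%:R * pi / p%:R &
              E = 2 * cos theta]]) :
  uniform_clock a b alpha beta.
Proof.
have [a0 _] := hab.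
have [a_tame b_tame] := tame_summable ha hb hsum.
have pi0 := pi_gt0 R; have p0 : 0 < p%:R :> R by rewrite ltr0n.
(* the segment in the angle: [`[alpha, beta]] is the image of [`[s, t]] *)
have in0pi (x : R) : 0 < x < pi -> x \in `[0, pi].
  by move=> /andP[/ltW x0 /ltW x1]; rewrite in_itv /= x0.
have [s s0pi es] : exists2 s : R, 0 < s < pi & beta = 2 * cos s.
  have [|s [s0pi _ es]] := hsub beta; first by rewrite /= in_itv /= hle lexx.
  by exists s.
have [t t0pi et] : exists2 t : R, 0 < t < pi & alpha = 2 * cos t.
  have [|t [t0pi _ et]] := hsub alpha; first by rewrite /= in_itv /= hle lexx.
  by exists t.
have le_angle (x y : R) : 0 < x < pi -> 0 < y < pi -> (x <= y) = (2 * cos y <= 2 * cos x).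
  by move=> x0 y0; rewrite ler_pM2l // [RHS]leNgt ltr_cos ?in0pi // -leNgt.
have angleP (E : R) : E \in `[alpha, beta] -> exists2 x : R, x \in `[s, t] & E = 2 * cos x.
  move=> Eab; have [|x [x0pi _ ex]] := hsub E; first by [].
  exists x => //; move: Eab; rewrite !in_itv /=.
  by rewrite (le_angle s x) // (le_angle x t) // -es -et -ex andbC.
have angle0pi (x : R) : x \in `[s, t] -> 0 < x < pi.
  move=> xst; have /andP[s0 _] := s0pi; have /andP[_ tpi] := t0pi.
  by move: xst; rewrite in_itv /= => /andP[sx xt]; rewrite (lt_le_trans s0) // (le_lt_trans xt).
have sin_neq0 : {in `[s, t], forall x, sin (p%:R * x) != 0}.
  move=> x xst; have x0pi := angle0pi _ xst; have /andP[x0 xpi] := x0pi.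
  have [|y [y0pi yk exy]] := hsub (2 * cos x).
    move: xst; rewrite /= !in_itv /=.
    by rewrite (le_angle s x) // (le_angle x t) // -es -et andbC.
  have exy' : x = y.
    by apply: cos_inj; rewrite ?in0pi //; apply: (mulfI _ exy); rewrite pnatr_eq0.
  apply/eqP => /sin_eq0_natpi[|k ek]; first by rewrite mulr_ge0 // ltW.
  have /yk : (1 <= k < p)%N.
    rewrite lt0n -(ltr_nat R); apply/andP; split.
      apply/eqP => k0; move: ek; rewrite k0 mul0r => /eqP.
      by rewrite mulf_eq0 !gt_eqF.
    by rewrite -(ltr_pM2r pi0) -ek ltr_pM2l.
  by rewrite -exy' -ek mulrAC divff ?mul1r ?eqxx // gt_eqF.
have [s0 tpi] : 0 < s /\ t < pi by case/andP: s0pi => ->; case/andP: t0pi.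
have st : s <= t by rewrite le_angle // -es -et.
have in2 (E : R) : E \in `[alpha, beta] -> E \in `]-2, 2[.
  by move=> /angleP[x /angle0pi x0pi ->]; exact: two_cos_itv.
exists (@arcsine_prob R), (@arcsine_density R); split.
- exact: zero_measure_weak_limit a0 a_tame b_tame hp.
- by [].
- apply: continuous_in_subspaceT => E; rewrite inE => /in2.
  exact: continuous_arcsine_density.
- by move=> E /in2/arcsine_density_gt0; apply: lt0r_neq0.
- apply/cvgrPdist_le => e e0.
  have := clock_spacing a0 a_tame b_tame hp s0 st tpi sin_neq0 e0.
  apply: filterS => n hn; rewrite sub0r normrN /clock_defect; set S := [set d | _].
  have Sub d : S d -> 0 <= d <= e.
    move=> [x [y [/angleP[u ust ->] /angleP[v vst ->] suc ->]]].
    by rewrite normr_ge0 hn.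
  have [->|/set0P[d Sd]] := eqVneq S set0.
    by rewrite sup0 normr0 ltW.
  have ubS : ubound S e by move=> d' /Sub /andP[].
  have S0 : S !=set0 by exists d.
  have /andP[d0 _] := Sub _ Sd.
  rewrite ger0_norm; first exact: ge_sup.
  by apply: le_trans d0 _; apply: ub_le_sup => //; exists e.
Qed.
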